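(* Let $k\ge3$, $e\ge 1$ and $\ell$ be integers with $0\le\ell\le2^{k-3}$. If $e\equiv-(2\ell+1)\pmod{2^k}$, then for all integers $n,w$ with $1\le w\le n-1$ there is no nontrivial $e$-perfect code in $J(n,w)$.
   Context: The Johnson scheme $J(n,w)$ has as elements all $w$-subsets of $[n]=\{1,\dots,n\}$, with distance $d(X,Y)=|X\setminus Y|$. The $e$-ball centred at $X$ is the set of $w$-subsets at distance at most $e$ from $X$. An $e$-perfect code in $J(n,w)$ is a set $\mathcal C$ of $w$-subsets such that the $e$-balls centred at the elements of $\mathcal C$ partition the set of all $w$-subsets of $[n]$. It is trivial if $e=0$, or $|\mathcal C|=1$, or $n=2w$, $w=2e+1$ and $\mathcal C$ consists of a $w$-subset and its complement; otherwise it is nontrivial. *)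

(* Defs.v *)
From mathcomp Require Import all_boot all_order all_algebra.

Set Implicit Arguments.
Unset Strict Implicit.
Unset Printing Implicit Defensive.

(* The ground set [n] = {1, ..., n} is represented by the ordinals 'I_n. *)

Definition johnson (n w : nat) : {set {set 'I_n}} :=
  [set X : {set 'I_n} | #|X| == w].

(* On w-subsets this is symmetric, as #|X :\: Y| = w - #|X :&: Y|. *)
Definition johnson_dist (n : nat) (X Y : {set 'I_n}) : nat := #|X :\: Y|.

Definition johnson_ball (n w e : nat) (X : {set 'I_n}) : {set {set 'I_n}} :=
  [set Y in johnson n w | johnson_dist X Y <= e].

(* The balls partition J(n,w) as a family indexed by the codewords: distinct
   codewords have disjoint balls.  Finset's [partition] applied to the set of
   balls would be weaker, since it identifies codewords with equal balls. *)
Definition perfect_code (n w e : nat) (C : {set {set 'I_n}}) : Prop :=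
  [/\ C \subset johnson n w,
      {in C &, forall X Y, X != Y ->
         [disjoint johnson_ball w e X & johnson_ball w e Y]}
    & \bigcup_(X in C) johnson_ball w e X = johnson n w].

Definition trivial_code (n w e : nat) (C : {set {set 'I_n}}) : Prop :=
  [\/ e = 0,
      #|C| = 1
    | [/\ n = w.*2, w = e.*2.+1
        & exists2 X, X \in johnson n w & C = [set X; ~: X]]].

Definition nontrivial_perfect_code (n w e : nat) (C : {set {set 'I_n}}) : Prop :=
  perfect_code w e C /\ ~ trivial_code w e C.

(* Main.v *)
Require Import Defs.
From mathcomp Require Import zify ring lra.
From mathcomp Require Import all_boot all_order all_algebra.

Set Implicit Arguments.
Unset Strict Implicit.
Unset Printing Implicit Defensive.

Import Order.TTheory GRing.Theory Num.Theory.

(** Write a = n - w and let Phi be the number of w-sets in an e-ball. The proof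
plays two facts about Phi against each other: Phi is a multiple of 4, while it
divides a binomial coefficient that is not. Complementing all codewords
exchanges w and a, so w <= a may be assumed.

Around a codeword X, every pair of an (e+1)-set S inside X and an (e+1)-set U
outside X is realized by exactly one codeword Z at the minimum distance 2e+1
that avoids S and contains U (block_exists, block_overlap). Fixing U makes the
sets X minus Z a Steiner system S(e+1, 2e+1, w), whence the divisibilities of
steiner_dvd. For e = -(2l+1) modulo 2^k they force the residue of w modulo 2^k
into [2^k - 4l - 1, 2^k - 2l - 1], and the same for a (residue_of_bin_dvd).
These residues are odd and, as l <= 2^(k-3), at least 2^(k-1) - 1; expanding
Phi by Vandermonde around the multiples of 2^k then shows that 4 divides Phi
(four_dvd_ball_size).

For the other half, a perfect code is a t-design with block count
C(n-t, w-t) / Phi as soon as the Lloyd polynomial has no zero among 1, ..., t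
(perfect_code_design): the weight Phi on codewords, minus 1 on all w-sets, has
zero sum over every ball, and the Lloyd values are the factors by which summing
over balls multiplies the parts of a weight that live on m-sets. The Lloyd
value at m is an alternating sum whose terms decrease, making it positive, when
(m-1) e^2 < (w-m-e+1)(a-m-e+1) (lloyd_gt0). This holds for all m < w/2 once w is
about 2e^2 + 4e (first_ratio_small). Steiner systems alone give only
w >= (e+1)(e+2), which is too small by a factor of two; comparing two sunflowers
of codewords that share e points inside X and e points outside gives what is
needed (two_sunflowers, sunflower_roos, block_count_large).

Finally let 2^s be the largest power of two with 2^s <= w, and t = w - 2^s, so
that t < w/2. The design property makes Phi a divisor of C(a + 2^s, 2^s). Since
a < 3 * 2^s, at most one carry occurs when 2^s is added to a, so by Kummer's
theorem this binomial coefficient is not divisible by 4. *)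

(** * Powers of two in binomial coefficients *)

(** Kummer's theorem: the sum counts the carries of a + b in base p. *)
Lemma logn_binD p a b : prime p ->
  logn p 'C(a + b, b) =
  \sum_(1 <= j < (a + b).+1) (p ^ j <= a %% p ^ j + b %% p ^ j).
Proof.
move=> p_pr.
have fact_trunc c : c <= a + b ->
    logn p c`! = \sum_(1 <= j < (a + b).+1) c %/ p ^ j.
  move=> le_c; rewrite logn_fact // [RHS](big_cat_nat (n := c.+1)) //=.
  rewrite [X in _ = _ + X]big_nat_cond [X in _ = _ + X]big1 ?addn0 // => j.
  case/andP=> /andP[lt_cj _] _; apply: divn_small.
  exact: leq_trans lt_cj (ltnW (ltn_expl _ (prime_gt1 p_pr))).
have := congr1 (logn p) (bin_fact (leq_addl a b)).
rewrite addnK lognM ?bin_gt0 ?muln_gt0 ?fact_gt0 ?leq_addl //.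
rewrite lognM ?fact_gt0 // !fact_trunc ?leq_addr ?leq_addl //.
have -> : \sum_(1 <= j < (a + b).+1) (a + b) %/ p ^ j =
    \sum_(1 <= j < (a + b).+1) (a %/ p ^ j + b %/ p ^ j
       + (p ^ j <= a %% p ^ j + b %% p ^ j)).
  by apply: eq_bigr => j _; rewrite divnD // expn_gt0 prime_gt0.
by rewrite !big_split /=; lia.
Qed.

Lemma two_carries a b j1 j2 : 0 < j1 < j2 ->
  2 ^ j1 <= a %% 2 ^ j1 + b %% 2 ^ j1 ->
  2 ^ j2 <= a %% 2 ^ j2 + b %% 2 ^ j2 ->
  4 %| 'C(a + b, b).
Proof.
case/andP=> j1_gt0 lt_j12 carry1 carry2.
have lt_ab j : 2 ^ j <= a %% 2 ^ j + b %% 2 ^ j -> j < (a + b).+1.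
  move=> carry; have := leq_mod a (2 ^ j); have := leq_mod b (2 ^ j).
  have := ltn_expl j (isT : 1 < 2); lia.
have := @pfactor_dvdn 2 2 'C(a + b, b) isT.
rewrite bin_gt0 leq_addl => -> //; rewrite logn_binD //.
rewrite (big_cat_nat (n := j2)) //=; [|lia|exact: ltnW (lt_ab _ carry2)].
rewrite (big_cat_nat (n := j1)) //=; last exact: ltnW.
rewrite [\sum_(j1 <= i < j2) _]big_ltn // [\sum_(j2 <= i < _) _]big_ltn ?lt_ab //.
by rewrite carry1 carry2; lia.
Qed.

(** Adding 2^s cannot carry below bit s, and the bound on a prevents a carry
out of bit s + 1. *)
Lemma logn_bin_pow2 a s : a < 3 * 2 ^ s -> logn 2 'C(a + 2 ^ s, 2 ^ s) <= 1.
Proof.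
move=> lt_a; rewrite logn_binD //.
have no_carry j : 1 <= j -> j != s.+1 ->
    (2 ^ j <= a %% 2 ^ j + 2 ^ s %% 2 ^ j) = false.
  move=> j_gt0 ne_js; apply: negbTE; rewrite -ltnNge.
  have pj : 0 < 2 ^ j by rewrite expn_gt0.
  case: (leqP j s) => [le_js | lt_sj].
    rewrite (eqP (dvdn_exp2l 2 le_js)) addn0; exact: ltn_pmod.
  have le_sj : s.+2 <= j by lia.
  have := leq_pexp2l (isT : 0 < 2) le_sj; rewrite !expnS => le_pow.
  have := leq_mod a (2 ^ j); have := leq_mod (2 ^ s) (2 ^ j); lia.
case: (leqP s.+2 (a + 2 ^ s).+1) => [le_s|lt_s].
  rewrite (big_cat_nat (n := s.+1)) //=; last exact: ltnW.
  rewrite big_nat_cond big1 ?add0n; last first.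
    by move=> j /andP[/andP[h1 h2] _]; rewrite no_carry // neq_ltn h2.
  rewrite big_ltn // big_nat_cond big1 ?addn0 ?leq_b1 //.
  by move=> j /andP[/andP[h1 h2] _]; rewrite no_carry //; lia.
rewrite big_nat_cond big1 // => j /andP[/andP[h1 h2] _].
by rewrite no_carry //; lia.
Qed.

(** If N modulo 2^k were at least r, the carries of (N - r) + r would all be
among the first k - 1 ones, too few for 2^k to divide C(N, r). *)
Lemma modn_lt_of_dvd_bin k N r : 2 ^ k %| 'C(N, r) -> 0 < r < 2 ^ k -> r <= N ->
  N %% 2 ^ k < r.
Proof.
move=> dvd_bin /andP[r_gt0 lt_r] le_rN; rewrite ltnNge; apply/negP => le_rM.
have pk j : 0 < 2 ^ j by rewrite expn_gt0.
have k_gt0 : 0 < k by case: k {dvd_bin le_rM} lt_r => //; rewrite expn0; lia.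
move: dvd_bin; rewrite pfactor_dvdn ?bin_gt0 //.
rewrite -(subnK le_rN) logn_binD // => le_k.
have no_carry j : k <= j ->
    (2 ^ j <= (N - r) %% 2 ^ j + r %% 2 ^ j) = false.
  move=> le_kj; apply: negbTE; rewrite -ltnNge.
  have le_pow : 2 ^ k <= 2 ^ j by rewrite leq_pexp2l.
  have r_small : r %% 2 ^ j = r by apply: modn_small; lia.
  have dvd_kj : 2 ^ k %| 2 ^ j by apply: dvdn_exp2l.
  have le_rNj : r <= N %% 2 ^ j.
    apply: leq_trans le_rM _; rewrite -(modn_dvdm N dvd_kj); exact: leq_mod.
  have {1}-> : N - r = N %/ 2 ^ j * 2 ^ j + (N %% 2 ^ j - r).
    by rewrite {1}(divn_eq N (2 ^ j)) addnBA.
  have := ltn_pmod N (pk j); move=> lt_Nj.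
  by rewrite modnMDl r_small modn_small; lia.
suff : \sum_(1 <= j < (N - r + r).+1) (2 ^ j <= (N - r) %% 2 ^ j + r %% 2 ^ j) <= k.-1 by lia.
case: (leqP k (N - r + r).+1) => [le_kN|lt_Nk].
  rewrite (big_cat_nat (n := k)) //=.
  rewrite [X in _ + X]big_nat_cond [X in _ + X]big1 ?addn0; last first.
    by move=> j /andP[/andP[h1 h2] _]; rewrite no_carry.
  apply: leq_trans (leq_sum _ (fun j _ => leq_b1 _)) _.
  by rewrite sum_nat_const_nat; lia.
apply: leq_trans (leq_sum _ (fun j _ => leq_b1 _)) _.
by rewrite sum_nat_const_nat; lia.
Qed.

(** From s * C(N, s) = N * C(N - 1, s - 1). *)
Lemma dvdn_binl p k r N s : prime p -> 0 < s ->
  p ^ (k + r) %| N -> ~~ (p ^ r.+1 %| s) -> p ^ k %| 'C(N, s).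
Proof.
move=> p_pr s_gt0 dvN ndv_s.
have := mul_bin_diag N s.-1; rewrite prednK // => eqN.
have : p ^ (k + r) %| s * 'C(N, s) by rewrite -eqN dvdn_mulr.
have [->|C_gt0] := posnP 'C(N, s); first by rewrite dvdn0.
rewrite pfactor_dvdn ?muln_gt0 ?s_gt0 // lognM // => le_kr.
rewrite pfactor_dvdn //; move: ndv_s; rewrite pfactor_dvdn //; lia.
Qed.

(** * The size of a ball is a multiple of 4 *)

(** Truncating at e loses no term of Vandermonde's identity, because C(p, i - s)
vanishes for i beyond s + p. *)
Lemma Vandermonde_shift p r s s' e : s + p <= e ->
  \sum_(i < e.+1 | (s <= i) && (s' <= i)) 'C(p, i - s) * 'C(r, i - s') =
  if s' <= s + p then 'C(r + p, s + p - s') else 0.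
Proof.
move=> le_spe; case: ifP => [le_s'|/negbT]; last first.
  rewrite -ltnNge => lt_s'; apply: big1 => i /andP[_ le_s'i].
  by rewrite bin_small // ; lia.
rewrite -binomial.Vandermonde -[RHS](big_mkord xpredT
  (fun j => 'C(r, j) * 'C(p, s + p - s' - j))).
have -> : (s + p - s').+1 = (s + p).+1 - s' by lia.
rewrite -[LHS](big_mkord (fun i => (s <= i) && (s' <= i))
  (fun i => 'C(p, i - s) * 'C(r, i - s'))).
transitivity (\sum_(s' <= i < (s + p).+1) 'C(r, i - s') * 'C(p, s + p - i)).
  rewrite [RHS](big_nat_widenl s' 0) // [RHS](big_nat_widen 0 _ e.+1) //.
  rewrite [LHS]big_mkcond [RHS]big_mkcond; apply: eq_bigr => i _ /=.
  rewrite (ltnS i) /=; case: (leqP s' i) => /= le_i; rewrite ?andbF //.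
  rewrite andbT; case: (leqP s i) => le_si.
    case: (leqP i (s + p)) => le_ip; last by rewrite bin_small //; lia.
    rewrite mulnC -(bin_sub (m := i - s)); last by lia.
    by congr (_ * 'C(_, _)); lia.
  case: ifP => // _; rewrite [X in _ * X]bin_small ?muln0 //; lia.
rewrite -{1}[s']add0n big_addn; apply: eq_bigr => j _.
by rewrite addnK; congr (_ * 'C(_, _)); lia.
Qed.

Lemma even_bin_odd n r : ~~ odd n -> odd r -> ~~ odd 'C(n, r).
Proof.
case: n r => [|n] [|r] //= n_odd r_even.
have := congr1 odd (mul_bin_diag n.+1 r); rewrite /= !oddM /= r_even /=.
by move: n_odd; rewrite negbK => -> /=; move <-.
Qed.

(** One carry occurs at the lowest bit. Another occurs at bit k - 1 when both
numbers have it; otherwise one of them is 2^(k-1) - 1, and the first carry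
propagates to the next bit. *)
Lemma four_dvd_bin_odd k p r : 2 < k -> odd p -> odd r ->
    (2 ^ k.-1).-1 <= p < 2 ^ k -> (2 ^ k.-1).-1 <= r < 2 ^ k ->
  4 %| 'C(r + p, p).
Proof.
move=> k_gt2 p_odd r_odd /andP[ge_p lt_p] /andP[ge_r lt_r].
have carry1 : 2 ^ 1 <= r %% 2 ^ 1 + p %% 2 ^ 1.
  by rewrite expn1 !modn2 p_odd r_odd.
have two_q : 2 ^ k = 2 * 2 ^ k.-1 by rewrite -expnS prednK //; lia.
have [/andP[big_p big_r]|] := boolP ((2 ^ k.-1 <= p) && (2 ^ k.-1 <= r)).
  apply: (@two_carries _ _ 1 k) => //; first exact: ltnW.
  by rewrite !modn_small // two_q mul2n -addnn leq_add.
rewrite negb_and -!ltnNge => small; apply: (@two_carries _ _ 1 2) => //.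
have /dvdnP[c def_q] : 2 ^ 2 %| 2 ^ k.-1 by apply: dvdn_exp2l; lia.
have q_gt0 : 0 < 2 ^ k.-1 by rewrite expn_gt0.
move: def_q q_gt0 ge_p ge_r small; rewrite -[2 ^ 2]/4.
by move: (2 ^ k.-1) p_odd r_odd; clear => q p_odd r_odd *; lia.
Qed.

Definition ball_size (w a e : nat) : nat := \sum_(i < e.+1) 'C(w, i) * 'C(a, i).

(** Expand both binomials of each term of the ball size by Vandermonde. C(N, s)
is divisible by 4 unless 2^(k-1) divides s, and even unless 2^k does, so only
shifts s, s' that are multiples of 2^(k-1), one of them even of 2^k, need a
look. For these the sum over i is complete, since p and r are at most e modulo
2^k, so it is zero or a binomial coefficient C(even, odd), hence even. If both
shifts are multiples of 2^k, it is zero for s <> s' and divisible by 4 for s = s'. *)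
Lemma four_dvd_ball_size k e N M p r : 2 < k ->
    2 ^ k %| N -> 2 ^ k %| M ->
    odd p -> odd r -> (2 ^ k.-1).-1 <= p -> (2 ^ k.-1).-1 <= r ->
    p <= e %% 2 ^ k -> r <= e %% 2 ^ k ->
  4 %| ball_size (N + p) (M + r) e.
Proof.
move=> k_gt2 dvN dvM p_odd r_odd ge_p ge_r le_p le_r.
have q_gt0 : 0 < 2 ^ k.-1 by rewrite expn_gt0.
have two_q : 2 ^ k = 2 * 2 ^ k.-1 by rewrite -expnS prednK //; lia.
have dv2q : 2 %| 2 ^ k.-1 by rewrite -{1}(expn1 2) dvdn_exp2l //; lia.
have lt_e : e %% 2 ^ k < 2 ^ k by rewrite ltn_pmod // expn_gt0.
have expand b c i : i < e.+1 ->
    'C(b + c, i) = \sum_(s < e.+1 | s <= i) 'C(b, s) * 'C(c, i - s).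
  move=> lt_i; rewrite -binomial.Vandermonde.
  by rewrite (big_ord_widen e.+1 (fun s => 'C(b, s) * 'C(c, i - s))).
have -> : ball_size (N + p) (M + r) e =
    \sum_(s < e.+1) \sum_(s' < e.+1) 'C(N, s) * 'C(M, s') *
    \sum_(i < e.+1 | (s <= i) && (s' <= i)) 'C(p, i - s) * 'C(r, i - s').
  rewrite /ball_size.
  transitivity (\sum_(i < e.+1) \sum_(s < e.+1) \sum_(s' < e.+1)
     if (s <= i) && (s' <= i) then
       'C(N, s) * 'C(M, s') * ('C(p, i - s) * 'C(r, i - s')) else 0).
    apply: eq_bigr => i _; rewrite !expand // big_distrlr /= big_mkcond.
    apply: eq_bigr => s _; case: leqP => _ /=; last by rewrite big1.
    rewrite big_mkcond; apply: eq_bigr => s' _; case: leqP => _ //=; lia.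
  rewrite exchange_big; apply: eq_bigr => s _.
  rewrite exchange_big; apply: eq_bigr => s' _.
  by rewrite -big_mkcond /= -big_distrr.
have add_le x t : x <= e %% 2 ^ k -> 2 ^ k %| t -> t <= e -> t + x <= e.
  move=> le_x /dvdnP[c def_t] le_t; rewrite (divn_eq e (2 ^ k)) leq_add //.
  by rewrite def_t leq_mul2r leq_divRL ?expn_gt0 // -def_t le_t orbT.
have inner_even x y s s' : odd x -> 2 ^ k %| s -> 2 ^ k.-1 %| s' ->
    x <= e %% 2 ^ k -> odd y -> s <= e ->
    ~~ odd (\sum_(i < e.+1 | (s <= i) && (s' <= i)) 'C(x, i - s) * 'C(y, i - s')).
  move=> x_odd dvs dvs' le_x y_odd le_s.
  rewrite Vandermonde_shift ?add_le //; case: ifP => // le_s'.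
  apply: even_bin_odd; first by rewrite oddD x_odd y_odd.
  have s_even : ~~ odd s by rewrite -dvdn2; apply: dvdn_trans dvs; rewrite two_q dvdn_mulr.
  have s'_even : ~~ odd s' by rewrite -dvdn2; apply: dvdn_trans dvs'.
  by rewrite oddB // oddD x_odd (negbTE s_even) (negbTE s'_even).
have dvd_bin_high K t : 2 ^ k %| K -> ~~ (2 ^ k.-1 %| t) -> 4 %| 'C(K, t).
  move=> dvK ndvt; have t_gt0 : 0 < t by case: t ndvt; rewrite ?dvdn0.
  apply: (@dvdn_binl 2 2 (k - 2)) => //; first by rewrite subnKC // ltnW.
  by have -> : (k - 2).+1 = k.-1 by lia.
have dvd_bin_low K t : 2 ^ k %| K -> ~~ (2 ^ k %| t) -> 2 %| 'C(K, t).
  move=> dvK ndvt; have t_gt0 : 0 < t by case: t ndvt; rewrite ?dvdn0.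
  apply: (@dvdn_binl 2 1 k.-1) => //; first by rewrite add1n prednK //; lia.
  by rewrite prednK //; lia.
apply: dvdn_sum => s _; apply: dvdn_sum => s' _.
have [dvs|ndvs] := boolP (2 ^ k.-1 %| s); last first.
  by rewrite -mulnA dvdn_mulr // dvd_bin_high.
have [dvs'|ndvs'] := boolP (2 ^ k.-1 %| s'); last first.
  by rewrite dvdn_mulr // dvdn_mull // dvd_bin_high.
have le_s : s <= e by rewrite -ltnS.
have le_s' : s' <= e by rewrite -ltnS.
have [dvs2|ndvs2] := boolP (2 ^ k %| s); have [dvs2'|ndvs2'] := boolP (2 ^ k %| s').
- (* Equal shifts give a binomial with two carries, distinct ones disjoint supports. *)
  have [eq_s|ne_s] := eqVneq (s : nat) s'.
    apply: dvdn_mull; rewrite -eq_s Vandermonde_shift ?add_le //.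
    rewrite leq_addr addKn.
    apply: (@four_dvd_bin_odd k) => //; apply/andP; split=> //.
      exact: leq_ltn_trans lt_e.
    exact: leq_ltn_trans lt_e.
  rewrite big1 ?muln0 // => i /andP[le_si le_s'i].
  suff : p < i - s \/ r < i - s'.
    by case=> lt_i; [rewrite (bin_small lt_i) | rewrite (bin_small lt_i) muln0].
  have /dvdnP[c def_s] := dvs2; have /dvdnP[c' def_s'] := dvs2'.
  have lt_p : p < 2 ^ k by apply: leq_ltn_trans lt_e.
  have lt_r : r < 2 ^ k by apply: leq_ltn_trans lt_e.
  move: ne_s; rewrite def_s def_s' in le_si le_s'i *; rewrite eqn_mul2r negb_or.
  case/andP=> _; rewrite neq_ltn => /orP[] lt_c; [left|right].
    have := leq_mul lt_c (leqnn (2 ^ k)); rewrite mulSn.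
    by move: lt_p le_s'i; clear; set K := 2 ^ k; lia.
  have := leq_mul lt_c (leqnn (2 ^ k)); rewrite mulSn.
  by move: lt_r le_si; clear; set K := 2 ^ k; lia.
- rewrite -mulnA dvdn_mull // (@dvdn_mul 2 2) ?dvd_bin_low // dvdn2.
  exact: inner_even.
- rewrite -mulnA (@dvdn_mul 2 2) //; first exact: dvd_bin_low.
  rewrite dvdn_mull // dvdn2.
  under eq_bigl do rewrite andbC. under eq_bigr do rewrite mulnC.
  exact: inner_even.
- by rewrite dvdn_mulr // (@dvdn_mul 2 2) // dvd_bin_low.
Qed.

(** * Lloyd's polynomial *)

Section Lloyd.
Local Open Scope ring_scope.

(** The eigenvalue of the e-ball operator of J(w + a, w) on its m-th eigenspace,
for m > 0; it is an Eberlein polynomial of J(w + a - 2, w - 1). *)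
Definition lloyd (w a e m : nat) : int :=
  \sum_(j < e.+1) (-1) ^+ j * ('C(m.-1, j) * 'C(w - m, e - j) * 'C(a - m, e - j))%N%:R.

Lemma alternating_sum_bound (T : nat -> nat) e :
    (forall j, (j < e)%N -> (T j.+1 <= T j)%N) ->
  0 <= \sum_(j < e.+1) ((-1) ^+ j * (T j)%:R : int) <= (T 0)%:R.
Proof.
elim: e T => [|e IHe] T T_dec.
  by rewrite big_ord_recl big_ord0 addr0 mul1r ler0n lexx.
rewrite big_ord_recl expr0 mul1r.
have := IHe (fun j => T j.+1) (fun j lt_j => T_dec j.+1 lt_j).
have -> : \sum_(i < e.+1) (-1) ^+ lift ord0 i * (T (lift ord0 i))%:R
    = - \sum_(i < e.+1) (-1) ^+ i * (T i.+1)%:R :> int.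
  by rewrite -sumrN; apply: eq_bigr => i _; rewrite /= exprS mulN1r mulNr.
have := T_dec 0%N isT; rewrite -(ler_nat int); lra.
Qed.

(** The hypothesis says that the second term is smaller than the first, and the
ratio of consecutive terms decreases. *)
Lemma lloyd_gt0 w a e m :
    (m.-1 * e ^ 2 < ((w - m).+1 - e) * ((a - m).+1 - e))%N ->
  0 < lloyd w a e m.
Proof.
set p := (w - m)%N; set r := (a - m)%N => small.
have /andP[le_ep le_er] : (e <= p)%N && (e <= r)%N.
  by have := leq_ltn_trans (leq0n _) small; rewrite muln_gt0 !subn_gt0 !ltnS.
pose T j := ('C(m.-1, j) * 'C(p, e - j) * 'C(r, e - j))%N.
have ratio j : (j < e)%N ->
    (T j.+1 * (j.+1 * ((p - (e - j.+1)) * (r - (e - j.+1)))) =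
     T j * ((m.-1 - j) * (e - j) ^ 2))%N.
  move=> lt_j; have e_j : (e - j = (e - j.+1).+1)%N by lia.
  have := mul_bin_left m.-1 j; have := mul_bin_left p (e - j.+1).
  have := mul_bin_left r (e - j.+1); rewrite /T -e_j => Er Ep Em.
  transitivity ((j.+1 * 'C(m.-1, j.+1)) * ((p - (e - j.+1)) * 'C(p, e - j.+1)) *
      ((r - (e - j.+1)) * 'C(r, e - j.+1)))%N; first by lia.
  by rewrite -Er -Ep Em; lia.
have le_ratio j : (j < e)%N ->
    ((m.-1 - j) * (e - j) ^ 2 <= m.-1 * e ^ 2)%N /\
    ((p.+1 - e) * (r.+1 - e) <= j.+1 * ((p - (e - j.+1)) * (r - (e - j.+1))))%N.
  move=> lt_j; split; first by rewrite leq_mul ?leq_sub ?leq_exp2r ?leq_subr.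
  by rewrite -[X in (X <= _)%N]mul1n leq_mul // leq_mul //; lia.
have T_dec j : (j < e)%N -> (T j.+1 <= T j)%N.
  move=> lt_j; have [le1 le2] := le_ratio j lt_j.
  have pos : (0 < j.+1 * ((p - (e - j.+1)) * (r - (e - j.+1))))%N.
    by rewrite !muln_gt0 !subn_gt0; lia.
  rewrite -(leq_pmul2r pos) ratio // leq_mul2l; apply/orP; right.
  exact: leq_trans le1 (leq_trans (ltnW small) le2).
have T0_gt0 : (0 < T 0)%N by rewrite /T bin0 subn0 mul1n muln_gt0 !bin_gt0 le_ep.
rewrite /lloyd -/p -/r (eq_bigr (fun j : 'I__ => (-1) ^+ j * (T j)%:R)) //.
rewrite big_ord_recl expr0 mul1r /=.
case: e le_ep le_er small T ratio le_ratio T_dec T0_gt0 => [|e] le_ep le_er small T.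
  by move=> _ _ _ T0; rewrite big_ord0 addr0 ltr0n.
move=> ratio le_ratio T_dec T0_gt0.
have lt_T : (T 1%N < T 0%N)%N.
  have [le1 le2] := le_ratio 0%N isT.
  have pos : (0 < 1 * ((p - (e.+1 - 1)) * (r - (e.+1 - 1))))%N.
    by rewrite !muln_gt0 !subn_gt0; lia.
  rewrite -(ltn_pmul2r pos) ratio // ltn_pmul2l //.
  exact: leq_ltn_trans le1 (leq_trans small le2).
have := @alternating_sum_bound (fun j => T j.+1) e (fun j lt_j => T_dec j.+1 lt_j).
have -> : \sum_(i < e.+1) (-1) ^+ lift ord0 i * (T (lift ord0 i))%:R
    = - \sum_(i < e.+1) (-1) ^+ i * (T i.+1)%:R :> int.
  by rewrite -sumrN; apply: eq_bigr => i _; rewrite /= exprS mulN1r mulNr.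
move: lt_T; rewrite -(ltr_nat int); lra.
Qed.

(** Polynomials in x over polynomials in y: the inner index is the degree in y. *)
Definition diag_sum e (P : {poly {poly int}}) : int := \sum_(i < e.+1) P`_i`_i.

Let x : {poly {poly int}} := 'X.
Let y : {poly {poly int}} := 'X%:P.

(** Multiplication by 1 - xy takes differences along the diagonal. *)
Lemma diag_sum_telescope e (P : {poly {poly int}}) :
  diag_sum e ((1 - x * y) * P) = P`_e`_e.
Proof.
rewrite /diag_sum; have coefE i : ((1 - x * y) * P)`_i`_i =
    P`_i`_i - (if i is j.+1 then P`_j`_j else 0).
  rewrite mulrBl mul1r coefB coefB -mulrA coefXM.
  by case: i => [|i] /=; rewrite ?coef0 // coefCM coefXM.
elim: e => [|e IHe]; first by rewrite big_ord_recl big_ord0 coefE subr0 addr0.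
by rewrite big_ord_recr /= IHe coefE addrC subrK.
Qed.

Lemma coef_XDn (R : nzRingType) n i : ((1 + 'X) ^+ n : {poly R})`_i = 'C(n, i)%:R.
Proof.
rewrite addrC exprD1n coef_sum.
under eq_bigr do rewrite coefMn coefXn.
have [lt_in|le_ni] := ltnP i n.+1.
  rewrite (bigD1 (Ordinal lt_in)) //= eqxx big1 ?addr0 // => j ne_j.
  rewrite [i == j]eq_sym (_ : (j == i :> nat) = false) ?mul0rn //.
  exact: negbTE ne_j.
rewrite bin_small // big1 // => j _; rewrite (_ : (i == j :> nat) = false) ?mul0rn //.
by have := ltn_ord j; lia.
Qed.

Lemma coef_shifted_pow j p h q i i' :
  (x ^+ j * (1 + x) ^+ p * (y ^+ h * (1 + y) ^+ q))`_i`_i' =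
  (if (j <= i)%N then 'C(p, i - j) else 0)%:R *
  (if (h <= i')%N then 'C(q, i' - h) else 0)%:R.
Proof.
have -> : y ^+ h * (1 + y) ^+ q = ('X ^+ h * (1 + 'X) ^+ q)%:P.
  by rewrite rmorphM !rmorphXn /= rmorphD rmorph1.
rewrite coefMC coefXnM ltnNge; case: leqP => _ /=; last by rewrite !mul0r coef0.
rewrite coef_XDn -polyCMn coefCM coefXnM ltnNge.
by case: leqP => _; rewrite /= ?mulr0 // coef_XDn.
Qed.

(** For |Y| = w and |A| = m, the number of w-sets that contain A and lie in the
ball around Y, where h is the number of points of A outside Y; the summation
index is the distance to Y (see card_ball_above). Writing C(a - h, a - i) rather
than C(a - h, i - h) makes the terms with i < h vanish. *)
Definition ball_above (w a e m h : nat) : nat :=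
  \sum_(i < e.+1) 'C(w - m + h, i) * 'C(a - h, a - i).

Lemma sum_ord_widen_supp (F : nat -> int) b1 b2 : (b1 <= b2)%N ->
  (forall j, (b1 <= j)%N -> F j = 0) -> \sum_(j < b1) F j = \sum_(j < b2) F j.
Proof.
move=> le_b F0; rewrite (big_ord_widen b2 F le_b) big_mkcond.
by apply: eq_bigr => j _; case: ltnP => // /F0.
Qed.

(** In generating functions the left side sums the diagonal coefficients of
((1+y) - y(1+x))^m (1+x)^(w-m) (1+y)^(a-m), whose first factor is (1-xy)^m;
one factor 1 - xy turns that diagonal sum into its last term. *)
Lemma alternating_ball_above w a e m : (0 < m)%N -> (m <= a)%N -> (e <= a)%N ->
  \sum_(h < m.+1) (-1) ^+ h * ('C(m, h) * ball_above w a e m h)%N%:R = lloyd w a e m.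
Proof.
move=> m_gt0 le_ma le_ea.
pose Q := (1 - x * y) ^+ m.-1 * ((1 + x) ^+ (w - m) * (1 + y) ^+ (a - m)).
transitivity (diag_sum e ((1 - x * y) * Q)); last first.
  rewrite diag_sum_telescope /Q exprBn mulr_suml !coef_sum /lloyd.
  pose G j : int := (-1) ^+ j * ('C(m.-1, j) *
    (if (j <= e)%N then 'C(w - m, e - j) else 0) *
    (if (j <= e)%N then 'C(a - m, e - j) else 0))%N%:R.
  transitivity (\sum_(j < m.-1.+1) G j).
    apply: eq_bigr => j _; rewrite expr1n mulr1 exprMn mulrnAl !coefMn.
    have -> : (-1) ^+ j = ((-1) ^+ j)%:P%:P :> {poly {poly int}}.
      by rewrite !rmorphXn !rmorphN1.
    have -> : ((-1) ^+ j)%:P%:P * (x ^+ j * y ^+ j) *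
        ((1 + x) ^+ (w - m) * (1 + y) ^+ (a - m)) = ((-1) ^+ j)%:P%:P *
       (x ^+ j * (1 + x) ^+ (w - m) * (y ^+ j * (1 + y) ^+ (a - m))) by ring.
    rewrite !coefCM -mulrnAr; congr (_ * _).
    by rewrite coef_shifted_pow !natrM -mulr_natl mulrA.
  transitivity (\sum_(j < m.-1.+1 + e.+1) G j); [|symmetry].
    apply: sum_ord_widen_supp; first exact: leq_addr.
    by move=> j lt_j; rewrite /G bin_small // mulr0.
  transitivity (\sum_(j < e.+1) G j).
    by apply: eq_bigr => j _; rewrite /G -ltnS ltn_ord.
  apply: sum_ord_widen_supp; first exact: leq_addl.
  by move=> j lt_j; rewrite /G leqNgt lt_j /= muln0 mulr0.
have -> : (1 - x * y) * Q = ((1 + y) - y * (1 + x)) ^+ m *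
     ((1 + x) ^+ (w - m) * (1 + y) ^+ (a - m)).
  rewrite /Q mulrA -exprS prednK //; congr (_ ^+ m * _); ring.
rewrite exprBn mulr_suml /diag_sum.
under [RHS]eq_bigr do rewrite !coef_sum.
rewrite exchange_big; apply: eq_bigr => h _ /=.
rewrite /ball_above natrM natr_sum !mulr_sumr; apply: eq_bigr => i _.
have le_h : (h <= m)%N by rewrite -ltnS.
have -> : (-1) ^+ h = ((-1) ^+ h)%:P%:P :> {poly {poly int}}.
  by rewrite !rmorphXn !rmorphN1.
have -> : ((-1) ^+ h)%:P%:P * (1 + y) ^+ (m - h) * (y * (1 + x)) ^+ h *+ 'C(m, h) *
    ((1 + x) ^+ (w - m) * (1 + y) ^+ (a - m)) =
    ((-1) ^+ h)%:P%:P * (x ^+ 0 * (1 + x) ^+ (w - m + h) *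
     (y ^+ h * (1 + y) ^+ (a - h))) *+ 'C(m, h).
  have -> : (a - h = (a - m) + (m - h))%N by lia.
  by rewrite mulrnAl; congr (_ *+ _); rewrite exprMn !exprD; ring.
rewrite !coefMn !coefCM coef_shifted_pow subn0 leq0n -mulrnAr; congr (_ * _).
rewrite natrM -[RHS]mulr_natl; congr (_ * (_ * _%:R)).
have le_ia : (i <= a)%N by apply: leq_trans le_ea; rewrite -ltnS.
case: leqP => [le_hi|lt_ih]; last by rewrite bin_small //; lia.
rewrite -(bin_sub (m := i - h)); last by lia.
by congr 'C(_, _); lia.
Qed.
End Lloyd.

(** * Counting sets *)

Section SetCounting.
Variable T : finType.
Implicit Types U Y I A H K : {set T}.

Lemma disjoint_setU1 b H K :
  [disjoint b |: H & K] = (b \notin K) && [disjoint H & K].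
Proof. by rewrite -setI_eq0 setIUl setU_eq0 !setI_eq0 disjoints1. Qed.

Lemma card_split_draws U Y i j :
  #|[set W : {set T} | [&& W \subset U, #|W :&: Y| == i & #|W :\: Y| == j]]| =
  'C(#|U :&: Y|, i) * 'C(#|U :\: Y|, j).
Proof.
rewrite -!cards_draws -cardsX.
set D := setX _ _; pose f (P : {set T} * {set T}) := P.1 :|: P.2.
have in_outY P : P \in D -> (f P :&: Y = P.1) * (f P :\: Y = P.2).
  case: P => P1 P2; rewrite !inE /= => /andP[/andP[sP1 _] /andP[sP2 _]].
  move: sP1 sP2; rewrite subsetI subsetD => /andP[_ sP1Y] /andP[_ dP2Y].
  rewrite /f /= setIUl setDUl (setIidPl sP1Y); split.
    by rewrite (disjoint_setI0 dP2Y) setU0.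
  by move: sP1Y; rewrite -setD_eq0 => /eqP ->; rewrite set0U; apply/setDidPl.
rewrite -(card_in_imset (f := f) (D := D)); last first.
  move=> P P' /in_outY[P1 P2] /in_outY[P1' P2'] eq_f.
  by rewrite [P]surjective_pairing [P']surjective_pairing -P1 -P2 -P1' -P2' eq_f.
apply: eq_card => W; rewrite !inE; apply/and3P/imsetP => [[sWU cI cD]|[P DP ->]].
  exists (W :&: Y, W :\: Y); last by rewrite /f setID.
  by rewrite !inE /= cI cD setSI ?setSD.
have [-> ->] := in_outY _ DP; move: DP; case: P => P1 P2; rewrite !inE /=.
rewrite subsetI subsetD => /andP[/andP[/andP[sP1 _] ->] /andP[/andP[sP2 _] ->]].
by rewrite subUset sP1.
Qed.

Lemma card_between I U c : I \subset U -> #|I| <= c ->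
  #|[set S : {set T} | [&& I \subset S, S \subset U & #|S| == c]]| =
  'C(#|U| - #|I|, c - #|I|).
Proof.
move=> sIU le_Ic; rewrite -(setIidPr sIU) -cardsD -[RHS]mul1n.
rewrite -[X in X * _](binn #|U :&: I|) -(card_split_draws U I).
rewrite (setIidPr sIU); apply: eq_card => S; rewrite !inE andbCA; congr (_ && _).
have := cardsID I S; case sIS: (I \subset S).
  by rewrite (setIidPr sIS) eqxx /= => <-; rewrite -[RHS](eqn_add2l #|I|) subnKC.
move=> _; apply/esym/negbTE; rewrite negb_and; apply/orP; left.
apply: contraFN sIS => /eqP cI; apply/setIidPr/eqP.
by rewrite eqEcard subsetIr cI leqnn.
Qed.

Local Open Scope ring_scope.

(** Each point moved from the avoided set H to the contained set K flips the
sign, as the condition that forgets this point involves fewer than m points and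
has sum zero. *)
Lemma sum_avoiding_sign (f : {set T} -> int) m :
    (forall A, (#|A| < m)%N -> \sum_(Y : {set T} | A \subset Y) f Y = 0) ->
  forall H K, [disjoint K & H] -> (#|K| + #|H| <= m)%N ->
    \sum_(Y : {set T} | (K \subset Y) && [disjoint H & Y]) f Y =
    (-1) ^+ #|H| * \sum_(Y : {set T} | K :|: H \subset Y) f Y.
Proof.
move=> f0 H; move: {2}#|H| (erefl #|H|) => h; elim: h H => [|h IHh] H cH K dKH le_m.
  have H0 : H = set0 by apply/eqP; rewrite -cards_eq0 cH.
  rewrite H0 cards0 mul1r setU0; apply: eq_bigl => Y.
  by rewrite -setI_eq0 set0I eqxx andbT.
have [b bH] : exists b, b \in H by apply/set0Pn; rewrite -card_gt0 cH.
set H' := H :\ b; have cH' : #|H'| = h by have := cardsD1 b H; rewrite bH cH => -[].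
have bK : b \notin K by apply: contraL bH => bK; rewrite (disjointFr dKH bK).
have dKH' : [disjoint K & H'] by rewrite (disjointWr _ dKH) // subD1set.
have splitY : \sum_(Y : {set T} | (K \subset Y) && [disjoint H' & Y]) f Y =
    \sum_(Y : {set T} | (b |: K \subset Y) && [disjoint H' & Y]) f Y +
    \sum_(Y : {set T} | (K \subset Y) && [disjoint H & Y]) f Y.
  rewrite (bigID (fun Y : {set T} => b \in Y)) /=; congr (_ + _); apply: eq_bigl => Y.
    by rewrite subUset sub1set andbC andbA.
  rewrite -(setD1K bH) disjoint_setU1 -/H' -andbA.
  by congr (_ && _); rewrite andbC.
have zero : \sum_(Y : {set T} | (K \subset Y) && [disjoint H' & Y]) f Y = 0.
  rewrite IHh //; last by move: le_m; rewrite cH cH'; lia.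
  rewrite f0 ?mulr0 // (leq_ltn_trans (leq_card_setU _ _)) //.
  by move: le_m; rewrite cH cH'; lia.
move: splitY; rewrite zero IHh //; last 2 first.
- by rewrite disjoint_setU1 dKH' andbT !inE eqxx.
- by rewrite cardsU1 bK; move: le_m; rewrite cH cH'; lia.
have -> : b |: K :|: H' = K :|: H by rewrite -(setD1K bH) -/H' setUA (setUC K).
by rewrite cH cH' exprS mulN1r mulNr => /esym/eqP; rewrite addrC addr_eq0 => /eqP.
Qed.
End SetCounting.

(** * Perfect codes as designs *)

(** Perfect codes over an arbitrary finite ground set; the counting form of the
partition into balls is the one that survives complementation and double
counting. *)
Definition perfect_cover (T : finType) (w e : nat) (C : {set {set T}}) : Prop :=
  (forall X : {set T}, X \in C -> #|X| = w) /\
  forall Y : {set T}, #|Y| = w -> #|[set X in C | #|X :\: Y| <= e]| = 1.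

Section PerfectCode.
Variables (T : finType) (n w e : nat).
Hypothesis card_T : #|T| = n.
Implicit Types (X Y Z A : {set T}) (C : {set {set T}}).

Lemma cardsD_sym X Y : #|X| = #|Y| -> #|X :\: Y| = #|Y :\: X|.
Proof.
move=> eqXY; apply/eqP; rewrite -(eqn_add2l #|X :&: Y|) cardsID.
by rewrite setIC cardsID eqXY.
Qed.

Lemma card_ball_above Y A : #|Y| = w -> #|A| <= w -> e <= n - w ->
  #|[set Z : {set T} | [&& #|Z| == w, A \subset Z & #|Y :\: Z| <= e]]| =
  ball_above w (n - w) e #|A| #|A :\: Y|.
Proof.
move=> cY le_A le_e.
have le_card (Z : {set T}) : #|Z| <= n by rewrite -card_T; apply: max_card.
have le_wn : w <= n by rewrite -cY.
have cardC (Z : {set T}) : #|~: Z| = n - #|Z| by rewrite cardsCs setCK card_T.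
pose D (i : 'I_e.+1) := [set W : {set T} |
  [&& W \subset ~: A, #|W :&: Y| == i & #|W :\: Y| == n - w - i]].
have -> : [set Z : {set T} | [&& #|Z| == w, A \subset Z & #|Y :\: Z| <= e]] =
    (@setC _) @: \bigcup_i D i.
  apply/setP => Z; rewrite -[Z]setCK mem_imset; last exact: setC_inj.
  set W := ~: Z; rewrite !inE cardC -setCS setCK setDE setCK.
  rewrite (setIC Y); apply/and3P/bigcupP => [[/eqP cW sWA le_i]|[i _]].
    have lt_i : #|W :&: Y| < e.+1 by [].
    exists (Ordinal lt_i) => //; rewrite inE sWA eqxx /=.
    by have := cardsID Y W; have := le_card W; lia.
  rewrite inE => /and3P[sWA /eqP cI /eqP cD].
  have := cardsID Y W; rewrite cI cD => cW; rewrite sWA -ltnS ltn_ord; split=> //.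
  by have := ltn_ord i; rewrite -cW; lia.
rewrite card_imset; last exact: setC_inj.
rewrite -sum1_card partition_disjoint_bigcup /=; last first.
  move=> i j ne_ij; rewrite -setI_eq0; apply/eqP/setP => W; rewrite !inE.
  apply: contraNF ne_ij => /andP[/and3P[_ /eqP ci _] /and3P[_ /eqP cj _]].
  by rewrite -val_eqE /= -ci -cj.
rewrite /ball_above; apply: eq_bigr => i _; rewrite sum1_card card_split_draws.
have cAY := cardsID Y A; have cYA := cardsID A Y; rewrite setIC in cYA.
congr ('C(_, _) * 'C(_, _)).
  by rewrite setIC -setDE; lia.
rewrite setDE -setCU cardC cardsU; have := cardsID A Y; rewrite setIC.
have := le_card (A :|: Y); rewrite cardsU; have := le_card Y; lia.
Qed.

Lemma card_ball_total Y : #|Y| = w -> e <= n - w ->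
  #|[set Z : {set T} | (#|Z| == w) && (#|Y :\: Z| <= e)]| = ball_size w (n - w) e.
Proof.
move=> JY le_e; have := @card_ball_above Y set0 JY; rewrite cards0 set0D cards0.
move=> /(_ isT le_e); under eq_finset do rewrite sub0set andTb.
move=> ->; apply: eq_bigr => i _; rewrite subn0 addn0; congr (_ * _).
by rewrite subn0 bin_sub //; apply: leq_trans le_e; rewrite -ltnS.
Qed.

Variable C : {set {set T}}.
Hypothesis perfectC : perfect_cover w e C.

Local Open Scope ring_scope.

(** By induction on |A|, the weight f (Phi on codewords, minus 1 on all w-sets)
has sum zero over the sets that contain A. Summing the vanishing ball sums over
the centres that contain A, and sorting by the part H of A that Y misses, every
H contributes the same sum over the supersets of A up to the sign (-1)^|H|; the
resulting factor is the Lloyd value at |A|. *)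
Lemma perfect_code_design t : (t <= w)%N -> (t <= n - w)%N -> (e <= n - w)%N ->
    (forall m, (0 < m <= t)%N -> lloyd w (n - w) e m != 0) ->
  forall A, (#|A| <= t)%N ->
  (ball_size w (n - w) e * #|[set Y in C | A \subset Y]| = 'C(n - #|A|, w - #|A|))%N.
Proof.
move=> le_tw le_ta le_ea lloyd_neq0.
set a := (n - w)%N in le_ta le_ea lloyd_neq0 *; have [Phi PhiE] : exists Phi, ball_size w a e = Phi by eexists.
rewrite PhiE.
pose f Y : int := (#|Y| == w)%:R * (Phi%:R * (Y \in C)%:R - 1).
have [cardC coverC] := perfectC.
have ball_sum0 Z : #|Z| = w ->
    \sum_(Y : {set T}) (#|Y :\: Z| <= e)%N%:R * f Y = 0.
  move=> cZ.
  transitivity (Phi%:R * #|[set Y in C | (#|Y :\: Z| <= e)%N]|%:R -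
     #|[set Y : {set T} | (#|Y| == w) && (#|Z :\: Y| <= e)%N]|%:R : int).
    rewrite -!sum1_card !natr_sum mulr_sumr.
    rewrite [X in X - _]big_mkcond [X in _ - X]big_mkcond -sumrB /=.
    apply: eq_bigr => Y _; rewrite !inE /f.
    have [cY|ncY] := eqVneq #|Y| w; last first.
      rewrite mul0r mulr0; case CY : (Y \in C) => /=; last by rewrite subr0.
      by rewrite (cardC _ CY) eqxx in ncY.
    rewrite mul1r (cardsD_sym (etrans cZ (esym cY))) /=.
    by case: (Y \in C); case: leqP => _ /=; ring.
  by rewrite coverC // card_ball_total // PhiE mulr1 subrr.
pose mu A := \sum_(Y : {set T} | A \subset Y) f Y.
suff mu0 (A : {set T}) : (#|A| <= t)%N -> mu A = 0.
  move=> A le_A; have := mu0 A le_A; rewrite /mu.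
  have -> : \sum_(Y : {set T} | A \subset Y) f Y =
      Phi%:R * #|[set Y in C | A \subset Y]|%:R -
      #|[set Y : {set T} | [&& A \subset Y, Y \subset setT & #|Y| == w]]|%:R.
    rewrite -!sum1_card !natr_sum mulr_sumr.
    rewrite [LHS]big_mkcond [X in X - _]big_mkcond [X in _ - X]big_mkcond -sumrB /=.
    apply: eq_bigr => Y _; rewrite !inE subsetT /f andbC.
    case: (A \subset Y) => /=; last by rewrite subrr.
    have [cY|ncY] := eqVneq #|Y| w; last first.
      rewrite mul0r; case CY : (Y \in C) => /=; last by rewrite subr0.
      by rewrite (cardC _ CY) eqxx in ncY.
    by rewrite mul1r; case: (Y \in C) => /=; ring.
  rewrite card_between ?subsetT // ?(leq_trans le_A) // cardsT card_T.
  by move/eqP; rewrite subr_eq0 -natrM eqr_nat => /eqP.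
move: {2}#|A| (leqnn #|A|) => m; elim/ltn_ind: m A => m IHm A le_Am le_At.
have [lt_Am|le_mA] := ltnP #|A| m; first exact: (IHm #|A|).
have {le_Am le_mA} cA : #|A| = m by apply/eqP; rewrite eqn_leq le_Am.
have f0 (B : {set T}) : (#|B| < m)%N -> mu B = 0.
  by move=> lt_B; apply: (IHm #|B|) => //; lia.
pose sigma : int := \sum_(h < m.+1) (-1) ^+ h * ('C(m, h) * ball_above w a e m h)%N%:R.
have sigma_neq0 : sigma != 0.
  have [m0|m_gt0] := posnP m.
    rewrite /sigma m0 big_ord_recl big_ord0 expr0 mul1r addr0 bin0 mul1n pnatr_eq0.
    rewrite -lt0n /ball_above big_ord_recl bin0 mul1n !subn0.
    by rewrite binn.
  by rewrite /sigma alternating_ball_above // ?lloyd_neq0 //; lia.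
apply/eqP; rewrite -(mulIr_eq0 _ (mulIf sigma_neq0)); apply/eqP.
have total0 : \sum_(Z : {set T} | (#|Z| == w) && (A \subset Z))
    \sum_(Y : {set T}) (#|Y :\: Z| <= e)%N%:R * f Y = 0.
  by rewrite big1 // => Z /andP[/eqP cZ _]; apply: ball_sum0.
rewrite -[RHS]total0 exchange_big /=.
transitivity (\sum_(Y : {set T}) (ball_above w a e m #|A :\: Y|)%:R * f Y); last first.
  apply: eq_bigr => Y _; rewrite -mulr_suml.
  have [cY|ncY] := eqVneq #|Y| w; last by rewrite /f (negbTE ncY) mul0r !mulr0.
  congr (_ * _); rewrite -cA -(card_ball_above cY) ?cA //; last by lia.
  rewrite -sum1_card natr_sum [LHS]big_mkcond [RHS]big_mkcond /=.
  apply: eq_bigr => Z _; rewrite !inE.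
  by case: (#|Z| == w); case: (A \subset Z); case: leqP.
rewrite (partition_big (fun Y => A :\: Y) (fun H => H \subset A)) /=; last first.
  by move=> Y _; apply: subsetDl.
transitivity (\sum_(H : {set T} | H \subset A)
    (ball_above w a e m #|H|)%:R * ((-1) ^+ #|H| * mu A)); last first.
  apply: eq_bigr => H sHA.
  rewrite (eq_bigr (fun Y => (ball_above w a e m #|H|)%:R * f Y)); last first.
    by move=> Y /eqP ->.
  rewrite -mulr_sumr; congr (_ * _).
  have -> : mu A = \sum_(Y : {set T} | A :\: H :|: H \subset Y) f Y.
    by rewrite setUC setDE setUIr setUCr setIT (setUidPr sHA).
  rewrite -(@sum_avoiding_sign _ f m); last first.
  - by rewrite -cA -(cardsID H A) (setIidPr sHA) addnC.
  - by rewrite disjoint_sym -setI_eq0 setIDA setIC -setIDA setDv setI0.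
  - by move=> B lt_B; apply: f0.
  apply: eq_bigl => Y; apply/andP/eqP => [[sAHY dHY]|<-].
    apply/setP => u; rewrite !inE; case uH : (u \in H).
      by rewrite (disjointFr dHY uH) (subsetP sHA).
    case uA : (u \in A); last by rewrite andbF.
    by rewrite (subsetP sAHY) // !inE uA uH.
  split; first by apply/subsetP => u; rewrite !inE; case: (u \in Y); case: (u \in A).
  rewrite -setI_eq0; apply/eqP/setP => u; rewrite !inE.
  by case: (u \in Y); rewrite ?andbF.
rewrite /sigma mulr_sumr.
rewrite [RHS](partition_big (fun H : {set T} => inord #|H| : 'I_m.+1) xpredT) //=.
apply: eq_bigr => h _.
rewrite (eq_bigl (fun H : {set T} => H \in [set B : {set T} | B \subset A & #|B| == h])); last first.
  move=> H; rewrite inE; case sHA: (H \subset A) => //=.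
  have lt_H : (#|H| < m.+1)%N by rewrite ltnS -cA subset_leq_card.
  by rewrite -val_eqE /= inordK.
rewrite (eq_bigr (fun _ => (ball_above w a e m h)%:R * ((-1) ^+ h * mu A))); last first.
  by move=> H; rewrite inE => /andP[_ /eqP ->].
rewrite sumr_const cards_draws cA natrM -mulr_natl; ring.
Qed.
End PerfectCode.

(** * Codewords at minimum distance *)

Lemma sum_incidence (I J : finType) (P : {set I}) (Q : {set J}) (r : I -> J -> bool) :
  \sum_(i in P) #|[set j in Q | r i j]| = \sum_(j in Q) #|[set i in P | r i j]|.
Proof.
transitivity (\sum_(i in P) \sum_(j in Q) (r i j : nat)); last rewrite exchange_big /=.
  apply: eq_bigr => i _; rewrite -sum1_card [RHS]big_mkcond [LHS]big_mkcond /=.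
  by apply: eq_bigr => j _; rewrite inE; case: (j \in Q); case: (r i j).
apply: eq_bigr => j _; rewrite -sum1_card [RHS]big_mkcond [LHS]big_mkcond /=.
by apply: eq_bigr => i _; rewrite inE; case: (i \in P); case: (r i j).
Qed.

Lemma exists_subset_card (T : finType) (U : {set T}) c :
  c <= #|U| -> exists2 D : {set T}, D \subset U & #|D| = c.
Proof.
move=> le_c; have : 0 < #|[set D : {set T} | D \subset U & #|D| == c]|.
  by rewrite cards_draws bin_gt0.
by rewrite card_gt0 => /set0Pn[D]; rewrite inE => /andP[sDU /eqP cD]; exists D.
Qed.

Section Blocks.
Variables (T : finType) (w e : nat).
Implicit Types (S U X Y Z D I : {set T}).
Variable C : {set {set T}}.
Hypothesis perfectC : perfect_cover w e C.

Lemma perfect_cover_exists Y : #|Y| = w -> exists2 X, X \in C & #|X :\: Y| <= e.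
Proof.
case: perfectC => _ cover cY; have : 0 < #|[set X in C | #|X :\: Y| <= e]| by rewrite cover.
by rewrite card_gt0 => /set0Pn[X]; rewrite inE => /andP[CX le_d]; exists X.
Qed.

Lemma perfect_cover_uniq X Z Y : #|Y| = w -> X \in C -> Z \in C ->
  #|X :\: Y| <= e -> #|Z :\: Y| <= e -> X = Z.
Proof.
case: perfectC => _ cover cY CX CZ dX dZ.
have /eqP/cards1P[V defV] := cover _ cY.
have : X \in [set V] by rewrite -defV inE CX.
have : Z \in [set V] by rewrite -defV inE CZ.
by rewrite !inE => /eqP -> /eqP.
Qed.

Lemma card_swap X D U : D \subset X -> [disjoint U & X] -> #|D| = #|U| ->
  #|(X :\: D) :|: U| = #|X|.
Proof.
move=> sDX dUX cDU; rewrite cardsU (_ : _ :&: U = set0) ?cards0 ?subn0.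
  by rewrite cardsD (setIidPr sDX) cDU subnK // -cDU subset_leq_card.
apply/setP => u; rewrite !inE; case uU : (u \in U); rewrite ?andbF //.
by rewrite (disjointFr dUX uU) andbF.
Qed.

(** Two closer codewords would have a w-set halfway between them in both balls. *)
Lemma min_distance X Z : X \in C -> Z \in C -> X != Z -> 2 * e < #|X :\: Z|.
Proof.
move=> CX CZ; apply: contraNltn => le_d; apply/eqP.
have [cardC _] := perfectC; set d := #|X :\: Z| in le_d.
have d_sym : #|Z :\: X| = d by apply: cardsD_sym; rewrite !cardC.
have [D sD cD] := @exists_subset_card _ (X :\: Z) _ (geq_minl d e).
have le_dZ : minn d e <= #|Z :\: X| by rewrite d_sym geq_minl.
have [U sU cU] := exists_subset_card le_dZ.
(* Replacing D by U in X moves it halfway towards Z. *)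
pose V := X :\: D :|: U.
move: sU; rewrite subsetD => /andP[sUZ dUX].
have sDX : D \subset X := subset_trans sD (subsetDl _ _).
have cV : #|V| = w by rewrite card_swap ?cD // cardC.
apply: (perfect_cover_uniq cV CX CZ).
  have sXV : X :\: V \subset D.
    by apply/subsetP => u; rewrite !inE; case: (u \in X); case: (u \in D); rewrite ?andbF.
  by apply: leq_trans (subset_leq_card sXV) _; rewrite cD geq_minr.
have sZV : Z :\: V \subset (Z :\: X) :\: U.
  apply/subsetP => u; rewrite !inE; case uZ: (u \in Z); rewrite ?andbF // !andbT.
  case uX: (u \in X); case uD: (u \in D); case: (u \in U) => //=.
  by have := subsetP sD _ uD; rewrite inE uZ.
apply: leq_trans (subset_leq_card sZV) _.
have sUZX : U \subset Z :\: X by rewrite subsetD sUZ.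
rewrite cardsD (setIidPr sUZX) d_sym cU; lia.
Qed.

(** The codeword covering (X minus S) plus U is not X, so its distance to X is
at least 2e+1; only a set that drops all of S and takes all of U gets there. *)
Lemma block_exists X S U : X \in C -> S \subset X -> [disjoint U & X] ->
    #|S| = e.+1 -> #|U| = e.+1 ->
  exists Z, [/\ Z \in C, #|X :\: Z| = (2 * e).+1, [disjoint S & Z] & U \subset Z].
Proof.
move=> CX sSX dUX cS cU; have [cardC _] := perfectC.
pose V := X :\: S :|: U.
have cV : #|V| = w by rewrite card_swap ?cS // cardC.
have [Z CZ dZV] := perfect_cover_exists cV.
have dVZ : #|V :\: Z| <= e by rewrite (cardsD_sym (etrans cV (esym (cardC _ CZ)))).
have neXZ : X != Z.
  apply: contraTneq dZV => <-; rewrite -ltnNge -cS subset_leq_card //.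
  apply/subsetP => u uS; rewrite !inE uS (subsetP sSX _ uS) andbT /=.
  by apply: contraTN (subsetP sSX _ uS) => /(disjointFr dUX) ->.
have far := min_distance CX CZ neXZ.
have cZX : #|Z :\: X| = #|X :\: Z| by apply: cardsD_sym; rewrite !cardC.
have sXZ : X :\: Z \subset (S :\: Z) :|: (V :\: Z).
  by apply/subsetP => u; rewrite !inE; case: (u \in Z); case: (u \in S); case: (u \in X).
have sZX : Z :\: X \subset (Z :\: V) :|: (U :&: Z).
  apply/subsetP => u; rewrite !inE.
  by case: (u \in Z); case: (u \in X); case: (u \in U); case: (u \in S).
have lt1 := subset_leq_card sXZ; have lt2 := subset_leq_card sZX.
have := cardsID Z S; have := subset_leq_card (subsetIl U Z).
have := leq_card_setU (S :\: Z) (V :\: Z); have := leq_card_setU (Z :\: V) (U :&: Z).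
move=> [leU _] [leS _] leI cSZ.
exists Z; split=> //; first by lia.
  by rewrite -setI_eq0 -cards_eq0; lia.
by apply/setIidPl/eqP; rewrite eqEcard subsetIl /=; lia.
Qed.

(** This is the minimum distance of Z1 and Z2, read off from their differences
with X. *)
Lemma block_overlap X Z1 Z2 : X \in C -> Z1 \in C -> Z2 \in C ->
    #|X :\: Z1| = (2 * e).+1 -> #|X :\: Z2| = (2 * e).+1 -> Z1 != Z2 ->
  #|(X :\: Z1) :&: (X :\: Z2)| + #|(Z1 :\: X) :&: (Z2 :\: X)| <= (2 * e).+1.
Proof.
move=> CX CZ1 CZ2 d1 d2 ne12; have [cardC _] := perfectC.
have far := min_distance CZ1 CZ2 ne12.
have c1 : #|Z1 :\: X| = (2 * e).+1 by rewrite -d1; apply: cardsD_sym; rewrite !cardC.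
have sZ : Z1 :\: Z2 \subset ((Z1 :\: X) :\: (Z2 :\: X)) :|: ((X :\: Z2) :\: (X :\: Z1)).
  by apply/subsetP => u; rewrite !inE; case: (u \in Z1); case: (u \in X); case: (u \in Z2).
have := subset_leq_card sZ.
have [le_U _] := leq_card_setU ((Z1 :\: X) :\: (Z2 :\: X)) ((X :\: Z2) :\: (X :\: Z1)).
have := cardsID (Z2 :\: X) (Z1 :\: X); have := cardsID (X :\: Z1) (X :\: Z2).
rewrite (setIC (X :\: Z2)); lia.
Qed.

Variable n : nat.
Hypothesis card_T : #|T| = n.

Lemma cards_compl Y : #|~: Y| = n - #|Y|.
Proof. by rewrite cardsCs setCK card_T. Qed.

Lemma exists_codeword : w <= n -> exists X, X \in C.
Proof.
rewrite -card_T -cardsT => le_w; have [Y _ cY] := exists_subset_card le_w.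
by have [X CX _] := perfect_cover_exists cY; exists X.
Qed.

Definition block_family X I U : {set {set T}} :=
  [set Z in C | [&& #|X :\: Z| == (2 * e).+1, [disjoint I & Z] & U \subset Z]].

Lemma block_family_uniq X S U Z1 Z2 : X \in C -> S \subset X -> [disjoint U & X] ->
    (2 * e).+1 < #|S| + #|U| ->
  Z1 \in block_family X S U -> Z2 \in block_family X S U -> Z1 = Z2.
Proof.
move=> CX sSX dUX lt_SU; rewrite !inE.
move=> /and4P[CZ1 /eqP d1 dS1 sU1] /and4P[CZ2 /eqP d2 dS2 sU2].
apply/eqP; apply: contraTT lt_SU => ne12; rewrite -leqNgt.
have sS : S \subset (X :\: Z1) :&: (X :\: Z2) by rewrite subsetI !subsetD sSX dS1 dS2.
have sU : U \subset (Z1 :\: X) :&: (Z2 :\: X) by rewrite subsetI !subsetD sU1 sU2 dUX.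
apply: leq_trans (block_overlap CX CZ1 CZ2 d1 d2 ne12).
exact: leq_add (subset_leq_card sS) (subset_leq_card sU).
Qed.

Lemma card_block_family X S U : X \in C -> S \subset X -> [disjoint U & X] ->
  #|S| = e.+1 -> #|U| = e.+1 -> #|block_family X S U| = 1.
Proof.
move=> CX sSX dUX cS cU.
have [Z [CZ dZ dSZ sUZ]] := block_exists CX sSX dUX cS cU.
have FZ : Z \in block_family X S U by rewrite inE CZ dZ eqxx dSZ sUZ.
apply/eqP/cards1P; exists Z; apply/setP => Z'; rewrite inE.
by apply/idP/eqP => [FZ'|->] //; apply: (block_family_uniq CX sSX dUX) FZ' FZ; rewrite cS cU; lia.
Qed.

(** For fixed U, the sets X minus Z, over the codewords Z at minimum distance that
contain U, form a Steiner system S(e+1, 2e+1, w) on X; the quotient is the number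
of its blocks through I. *)
Lemma steiner_dvd j : w <= n -> e.+1 <= w -> e.+1 <= n - w -> j <= e.+1 ->
  'C(e + j, j) %| 'C(w - e.+1 + j, j).
Proof.
move=> le_wn le_ew le_ea le_j; have [X CX] := exists_codeword le_wn.
have [cardC _] := perfectC; have cX := cardC X CX.
have le_eC : e.+1 <= #|~: X| by rewrite cards_compl cX.
have [U sU cU] := exists_subset_card le_eC.
have dUX : [disjoint U & X] by rewrite disjoints_subset.
have le_i : e.+1 - j <= #|X| by lia.
have [I sIX cI] := exists_subset_card le_i.
pose P := [set S : {set T} | [&& I \subset S, S \subset X & #|S| == e.+1]].
have := @sum_incidence _ _ P (block_family X I U) (fun S Z => [disjoint S & Z]).
rewrite (eq_bigr (fun _ => 1)); last first.
  move=> S; rewrite inE => /and3P[sIS sSX /eqP cS].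
  rewrite -(card_block_family CX sSX dUX cS cU); apply: eq_card => Z; rewrite !inE.
  case dSZ : [disjoint S & Z]; rewrite ?andbF // andbT.
  by rewrite (disjointWl sIS dSZ).
rewrite sum1_card card_between ?cI; [|by []|by lia].
rewrite (eq_bigr (fun _ => 'C(e + j, j))); last first.
  move=> Z; rewrite inE => /and4P[CZ /eqP dZ dIZ sUZ].
  transitivity #|[set S : {set T} | [&& I \subset S, S \subset X :\: Z & #|S| == e.+1]]|.
    apply: eq_card => S; rewrite !inE subsetD.
    by case: (I \subset S); case: (S \subset X); case: [disjoint S & Z]; rewrite ?andbF ?andbT.
  rewrite card_between ?cI ?dZ; [|by rewrite subsetD sIX|by lia].
  by congr 'C(_, _); lia.
rewrite sum_nat_const cX => eqC; apply/dvdnP; exists #|block_family X I U|.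
by rewrite -eqC; congr 'C(_, _); lia.
Qed.

(** Here #|I| = e while #|U| = e + 1, so the family consists of codewords whose
differences with X are pairwise disjoint outside I and U. Inside X they cover
every point off I exactly once. *)
Section Sunflower.
Variables (X I : {set T}).
Hypotheses (CX : X \in C) (sIX : I \subset X) (cI : #|I| = e).
Let cX : #|X| = w := perfectC.1 X CX.

Section OneSunflower.
Variable U : {set T}.
Hypotheses (dUX : [disjoint U & X]) (cU : #|U| = e.+1).
Local Notation F := (block_family X I U).

Lemma sunflower_missing s : s \in X :\: I -> #|[set Z in F | s \notin Z]| = 1.
Proof.
rewrite inE => /andP[sI sX].
rewrite -(@card_block_family X (s |: I) U) ?cardsU1 ?sI ?cI //.
  by apply: eq_card => Z; rewrite !inE disjoint_setU1; case: (s \in Z); rewrite /= ?andbF ?andbT.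
by rewrite subUset sub1set sX.
Qed.

Lemma sunflower_meeting v : v \in ~: X :\: U -> #|[set Z in F | v \in Z]| <= 1.
Proof.
rewrite !inE => /andP[vU vX]; apply/card_le1_eqP => Z1 Z2.
have sub Z : Z \in [set Z in F | v \in Z] -> Z \in block_family X I (v |: U).
  by rewrite !inE subUset sub1set => /andP[/and4P[-> -> -> ->] ->].
move=> /sub F1 /sub F2; apply: (block_family_uniq CX sIX _ _ F2 F1).
  by rewrite disjoint_setU1 vX.
by rewrite cI cardsU1 vU cU; lia.
Qed.

Lemma card_sunflower : #|F| * e.+1 = w - e.
Proof.
have := sum_incidence (X :\: I) F (fun s Z => s \notin Z).
rewrite (eq_bigr (fun _ => 1)) ?sum1_card; last exact: sunflower_missing.
rewrite cardsD (setIidPr sIX) cX cI => ->; rewrite -sum_nat_const.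
apply: eq_bigr => Z; rewrite inE => /and4P[_ /eqP dZ dIZ _].
have sIXZ : I \subset X :\: Z by rewrite subsetD sIX.
have := cardsD (X :\: Z) I; rewrite (setIidPr sIXZ) dZ cI => cD.
transitivity #|X :\: Z :\: I|; first by lia.
by apply: eq_card => s; rewrite !inE; case: (s \in Z); rewrite /= ?andbF ?andbT.
Qed.

Lemma sum_sunflower_meeting (W : {set T}) : W \subset ~: X ->
    (forall Z, Z \in F -> Z :\: X :\: U \subset W) -> [disjoint U & W] ->
  \sum_(v in W) #|[set Z in F | v \in Z]| = #|F| * e.
Proof.
move=> sWX sZW dUW; rewrite sum_incidence -sum_nat_const.
apply: eq_bigr => Z FZ; move: (FZ); rewrite inE => /and4P[CZ /eqP dZ _ sUZ].
have cZX : #|Z :\: X| = (2 * e).+1.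
  by rewrite -dZ; apply: cardsD_sym; rewrite cX perfectC.1.
have sUZX : U \subset Z :\: X by rewrite subsetD sUZ.
have := cardsD (Z :\: X) U; rewrite (setIidPr sUZX) cZX cU => cD.
transitivity #|Z :\: X :\: U|; last by lia.
apply: eq_card => v; rewrite !inE; case vW: (v \in W) => /=.
  have := subsetP sWX _ vW; rewrite inE => ->.
  by rewrite (disjointFl dUW vW).
symmetry; apply: contraFF vW => vZ; apply: (subsetP (sZW _ FZ)).
by rewrite !inE.
Qed.

(** The petals outside X, of size e each, are disjoint. *)
Lemma sunflower_roos : e * #|F| + e.+1 <= n - w.
Proof.
have dU : [disjoint U & ~: X :\: U].
  by rewrite disjoint_sym disjoints_subset; apply/subsetP => v; rewrite !inE => /andP[].
have eq_sum : \sum_(v in ~: X :\: U) #|[set Z in F | v \in Z]| = #|F| * e.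
  apply: sum_sunflower_meeting => // [|Z _]; first exact: subsetDl.
  by apply/subsetP => v; rewrite !inE => /and3P[-> ->].
have : \sum_(v in ~: X :\: U) #|[set Z in F | v \in Z]| <= #|~: X :\: U|.
  rewrite -sum1_card; apply: leq_sum => v; exact: sunflower_meeting.
have sUX : U \subset ~: X by rewrite -disjoints_subset.
have := subset_leq_card sUX.
rewrite eq_sum cardsD (setIidPr sUX) cards_compl cX cU; lia.
Qed.
End OneSunflower.

(** The petals of the two sunflowers are compared pairwise. Any two of them meet in
at most one point, inside or outside X, beyond their common 2e points; so the
number of pairs bounds the total intersection. Inside X this total is w - e,
because both sunflowers cover every point there once; outside X, two families of
disjoint petals in a set only slightly larger than their unions must overlap
almost everywhere. *)
Lemma two_sunflowers U0 p q : [disjoint U0 & X] -> #|U0| = e ->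
    p \notin U0 -> q \notin U0 -> p \notin X -> q \notin X -> p != q ->
    (forall Z, Z \in block_family X I (p |: U0) -> q \notin Z) ->
  #|block_family X I (p |: U0)| * e.+1 + 2 * (#|block_family X I (p |: U0)| * e) + e.+2 <=
  #|block_family X I (p |: U0)| ^ 2 + (n - w).
Proof.
move=> dU0 cU0 pU0 qU0 pX qX ne_pq no_q.
set F1 := block_family X I (p |: U0); pose F2 := block_family X I (q |: U0).
have d1 : [disjoint p |: U0 & X] by rewrite disjoint_setU1 pX.
have d2 : [disjoint q |: U0 & X] by rewrite disjoint_setU1 qX.
have c1 : #|p |: U0| = e.+1 by rewrite cardsU1 pU0 cU0.
have c2 : #|q |: U0| = e.+1 by rewrite cardsU1 qU0 cU0.
have no_p Z : Z \in F2 -> p \notin Z.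
  move=> F2Z; move: (F2Z); rewrite inE subUset sub1set => /and5P[CZ dZ dIZ qZ sU0Z].
  apply: contraL qZ => pZ; apply: no_q.
  by rewrite inE CZ dZ dIZ subUset sub1set pZ.
pose W := ~: X :\: [set p; q] :\: U0.
have sWX : W \subset ~: X by apply/subsetP => v; rewrite !inE => /and3P[].
have cF : #|F2| = #|F1|.
  have := card_sunflower d1 c1; have := card_sunflower d2 c2; rewrite -/F1 -/F2.
  by move=> <- /eqP; rewrite eqn_mul2r /= => /eqP.
have sum1 : \sum_(v in W) #|[set Z in F1 | v \in Z]| = #|F1| * e.
  apply: sum_sunflower_meeting => // [Z F1Z|].
    apply/subsetP => v; rewrite !inE negb_or => /andP[/andP[vp vU0] /andP[vX vZ]].
    rewrite vU0 vX (negbTE vp) andbT /=; apply: contraTneq vZ => ->; exact: no_q.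
  by rewrite -setI_eq0; apply/eqP/setP => v; rewrite !inE; case: (v == p); case: (v \in U0).
have sum2 : \sum_(v in W) #|[set Z in F2 | v \in Z]| = #|F1| * e.
  rewrite -cF; apply: sum_sunflower_meeting => // [Z F2Z|].
    apply/subsetP => v; rewrite !inE negb_or => /andP[/andP[vq vU0] /andP[vX vZ]].
    rewrite vU0 vX (negbTE vq) andbT orbF /=; apply: contraTneq vZ => ->; exact: no_p.
  rewrite -setI_eq0; apply/eqP/setP => v; rewrite !inE.
  by case: (v == p); case: (v == q); case: (v \in U0).
have sub1 v : v \in W -> v \in ~: X :\: (p |: U0).
  by rewrite !inE !negb_or => /and3P[-> /andP[-> _] ->].
have sub2 v : v \in W -> v \in ~: X :\: (q |: U0).
  by rewrite !inE !negb_or => /and3P[-> /andP[_ ->] ->].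
have pairE (r1 r2 : {set T} -> bool) :
    #|[set z in setX F1 F2 | r1 z.1 && r2 z.2]| =
    #|[set Z in F1 | r1 Z]| * #|[set Z in F2 | r2 Z]|.
  by rewrite -cardsX; apply: eq_card => -[Z1 Z2]; rewrite !inE /= andbACA.
have := sum_incidence (X :\: I) (setX F1 F2) (fun s z => (s \notin z.1) && (s \notin z.2)).
rewrite (eq_bigr (fun _ => 1)) => [|s XIs]; last first.
  by rewrite (pairE (fun Z => s \notin Z) (fun Z => s \notin Z)) !sunflower_missing.
rewrite sum1_card cardsD (setIidPr sIX) cX cI => sumX.
have := sum_incidence W (setX F1 F2) (fun v z => (v \in z.1) && (v \in z.2)).
rewrite (eq_bigr (fun v => #|[set Z in F1 | v \in Z]| * #|[set Z in F2 | v \in Z]|)); last first.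
  by move=> v _; apply: (pairE (fun Z => v \in Z) (fun Z => v \in Z)).
move=> sumW.
have pair_le z : z \in setX F1 F2 ->
    #|[set s in X :\: I | (s \notin z.1) && (s \notin z.2)]| +
    #|[set v in W | (v \in z.1) && (v \in z.2)]| <= 1.
  case: z => Z1 Z2; rewrite inE /= => /andP[F1Z F2Z].
  have ne12 : Z1 != Z2.
    apply: contraTneq F2Z => <-; rewrite inE subUset sub1set.
    by rewrite (negbTE (no_q _ F1Z)) /= !andbF.
  move: F1Z F2Z; rewrite !inE !subUset !sub1set.
  move=> /and5P[CZ1 /eqP dZ1 dI1 pZ1 sU1] /and5P[CZ2 /eqP dZ2 dI2 qZ2 sU2].
  have := block_overlap CX CZ1 CZ2 dZ1 dZ2 ne12.
  have sI : I \subset (X :\: Z1) :&: (X :\: Z2) by rewrite subsetI !subsetD sIX dI1 dI2.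
  have sU : U0 \subset (Z1 :\: X) :&: (Z2 :\: X) by rewrite subsetI !subsetD sU1 sU2 dU0.
  have := cardsD ((X :\: Z1) :&: (X :\: Z2)) I; rewrite (setIidPr sI) cI => cDI.
  have := cardsD ((Z1 :\: X) :&: (Z2 :\: X)) U0; rewrite (setIidPr sU) cU0 => cDU.
  have lt1 : #|[set s in X :\: I | (s \notin Z1) && (s \notin Z2)]| <=
      #|((X :\: Z1) :&: (X :\: Z2)) :\: I|.
    by apply: subset_leq_card; apply/subsetP => s; rewrite !inE => /andP[/andP[-> ->] /andP[-> ->]].
  have lt2 : #|[set v in W | (v \in Z1) && (v \in Z2)]| <=
      #|((Z1 :\: X) :&: (Z2 :\: X)) :\: U0|.
    apply: subset_leq_card; apply/subsetP => s; rewrite !inE.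
    by move=> /andP[/and3P[-> _ ->] /andP[-> ->]].
  have := subset_leq_card sI; have := subset_leq_card sU; rewrite cI cU0.
  clear - cDI cDU lt1 lt2; lia.
have : \sum_(z in setX F1 F2)
    (#|[set s in X :\: I | (s \notin z.1) && (s \notin z.2)]| +
     #|[set v in W | (v \in z.1) && (v \in z.2)]|) <= \sum_(z in setX F1 F2) 1.
  exact: leq_sum.
rewrite big_split /= -sumX -sumW sum1_card cardsX cF.
have : \sum_(v in W) (#|[set Z in F1 | v \in Z]| + #|[set Z in F2 | v \in Z]|) <=
    \sum_(v in W) (#|[set Z in F1 | v \in Z]| * #|[set Z in F2 | v \in Z]| + 1).
  apply: leq_sum => v Wv.
  have := sunflower_meeting d1 c1 (sub1 _ Wv).
  have := sunflower_meeting d2 c2 (sub2 _ Wv); rewrite -/F1 -/F2.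
  by case: #|[set Z in F1 | _]| => [|[|]] //; case: #|[set Z in F2 | _]| => [|[|]].
rewrite !big_split /= sum1 sum2 sum1_card (card_sunflower d1 c1).
have spq : [set p; q] \subset ~: X.
  by apply/subsetP => v; rewrite !inE => /orP[] /eqP ->.
have sU0 : U0 \subset ~: X :\: [set p; q].
  apply/subsetP => v vU0; rewrite !inE negb_or (disjointFr dU0 vU0) andbT.
  by apply/andP; split; [move: pU0|move: qU0]; apply: contraNneq => <-.
have cW : #|W| + e.+2 = n - w.
  have := subset_leq_card spq; have := subset_leq_card sU0.
  rewrite /W !cardsD (setIidPr spq) (setIidPr sU0) cards2 ne_pq cards_compl cX cU0.
  by clear; lia.
rewrite -cW; by move: #|F1| #|W| => y u; clear; set sP := \sum_(z in _) _; lia.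
Qed.
End Sunflower.

(** The second bound is Roos's inequality for the parameters of perfect codes. *)
Lemma card_quotient_roos : w <= n -> e < w -> e < n - w ->
  exists2 y, w = y * e.+1 + e & e * y + e.+1 <= n - w.
Proof.
move=> le_wn lt_ew lt_ea; have [X CX] := exists_codeword le_wn.
have cX := perfectC.1 _ CX; have le_eX : e <= #|X| by rewrite cX ltnW.
have [I sIX cI] := exists_subset_card le_eX.
have le_eC : e.+1 <= #|~: X| by rewrite cards_compl cX.
have [U sU cU] := exists_subset_card le_eC.
have dUX : [disjoint U & X] by rewrite disjoints_subset.
exists #|block_family X I U|; last exact: sunflower_roos.
by rewrite card_sunflower // subnK // ltnW.
Qed.

Lemma two_sunflowers_bound y : w <= n -> e < w -> w = y * e.+1 + e ->
    e * y + e.+1 < n - w ->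
  y * e.+1 + 2 * (y * e) + e.+2 <= y ^ 2 + (n - w).
Proof.
move=> le_wn lt_ew def_w lt_a; have [X CX] := exists_codeword le_wn.
have cX := perfectC.1 _ CX; have le_eX : e <= #|X| by rewrite cX ltnW.
have [I sIX cI] := exists_subset_card le_eX.
have le_eC : e.+1 <= #|~: X| by rewrite cards_compl cX; lia.
have [U sU cU] := exists_subset_card le_eC.
have [p Up] : exists p, p \in U by apply/set0Pn; rewrite -card_gt0 cU.
pose U0 := U :\ p; have defU : p |: U0 = U by apply: setD1K.
have pU0 : p \notin U0 by rewrite !inE eqxx.
have cU0 : #|U0| = e by have := cardsD1 p U; rewrite Up cU; case.
have dUX : [disjoint U & X] by rewrite disjoints_subset.
have cF : #|block_family X I U| = y.
  have := card_sunflower CX sIX cI dUX cU; rewrite def_w addnK => /eqP.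
  by rewrite eqn_mul2r => /eqP.
have [q qW no_q] : exists2 q, q \in ~: X :\: U &
    [set Z in block_family X I U | q \in Z] == set0.
  apply/exists_inP; apply: contraTT lt_a => /exists_inPn none; rewrite -leqNgt.
  have dUW : [disjoint U & ~: X :\: U].
    by rewrite disjoint_sym disjoints_subset; apply/subsetP => v; rewrite !inE => /andP[].
  have := sum_sunflower_meeting CX sIX cI dUX cU (subsetDl _ _) _ dUW.
  rewrite cF => sumE.
  have : \sum_(v in ~: X :\: U) 1 <=
      \sum_(v in ~: X :\: U) #|[set Z in block_family X I U | v \in Z]|.
    by apply: leq_sum => v Wv; rewrite card_gt0 none.
  rewrite sumE => [|Z _]; last by apply/subsetP => v; rewrite !inE => /and3P[-> ->].
  rewrite sum1_card cardsD (setIidPr sU) cards_compl cX cU; lia.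
have /andP[qU qX] : (q \notin U) && (q \notin X) by move: qW; rewrite !inE.
have qU0 : q \notin U0 by apply: contra qU; rewrite !inE => /andP[].
have pX : p \notin X by rewrite (disjointFr dUX Up).
have dU0 : [disjoint U0 & X] by rewrite (disjointWl _ dUX) // subD1set.
have ne_pq : p != q by apply: contraNneq qU => <-.
have := two_sunflowers CX sIX cI dU0 cU0 pU0 qU0 pX qX ne_pq; rewrite defU cF; apply.
move=> Z FZ; apply/negP => qZ; have := eqP no_q => /setP/(_ Z).
by rewrite [in LHS]inE FZ qZ inE.
Qed.
End Blocks.

(** * Nonexistence *)

Lemma perfect_cover_compl (T : finType) n w e (C : {set {set T}}) : #|T| = n -> w <= n ->
  perfect_cover w e C -> perfect_cover (n - w) e [set ~: X | X in C].
Proof.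
move=> card_T le_wn [cardC cover]; split=> [X /imsetP[Y CY ->]|Y cY].
  by rewrite (cards_compl card_T) cardC.
have cY' : #|~: Y| = w by rewrite (cards_compl card_T) cY subKn.
rewrite -(cover _ cY') -(card_imset _ (@setC_inj T)); apply: eq_card => Z.
rewrite -[Z]setCK mem_imset; last exact: setC_inj.
rewrite !inE mem_imset; last exact: setC_inj.
rewrite !setCK; case CX : (Z \in C) => //=; have cZ := cardC _ CX.
have -> : ~: Z :\: Y = ~: Y :\: Z by rewrite !setDE setIC.
by rewrite (cardsD_sym (etrans cZ (esym cY'))).
Qed.

(** The worst case is a = w and m = w/2, where the inequality is roughly
2 e^2 w < (w - 2e)^2, hence the need for w >= 2e^2 + 4e + 1. *)
Lemma first_ratio_small e y w a m : 1 < e -> w = y * e.+1 + e -> w <= a ->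
    (2 * e < y) \/ (y = 2 * e /\ w + e.+1 <= a) -> 0 < m -> 2 * m < w ->
  m.-1 * e ^ 2 < ((w - m).+1 - e) * ((a - m).+1 - e).
Proof.
move=> e_gt1 def_w le_wa big m_gt0 lt_m.
rewrite -(ltn_pmul2l (isT : 0 < 2 * 2)) [leqRHS]mulnACA.
have -> : 2 * 2 * (m.-1 * e ^ 2) = 2 * m.-1 * (2 * e ^ 2) by ring.
have y_gt0 : 0 < y by clear - big e_gt1; lia.
have le_ew : 2 * e <= w by have := leq_pmull e.+1 y_gt0; rewrite def_w; lia.
have le_m : 2 * m.-1 <= w - 3 by clear - m_gt0 lt_m; lia.
have le_A : w + 3 - 2 * e <= 2 * ((w - m).+1 - e) by clear - lt_m; lia.
have le_B : w + 3 - 2 * e + 2 * (a - w) <= 2 * ((a - m).+1 - e).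
  by clear - lt_m le_wa le_ew; lia.
apply: leq_ltn_trans (leq_mul le_m (leqnn _)) _.
apply: leq_trans (leq_mul le_A le_B).
clear lt_m le_m le_A le_B m_gt0; case: big => [lt_y|[def_y le_a]].
  have [s def_y] : exists s, y = (2 * e).+1 + s by exists (y - (2 * e).+1); lia.
  have {}def_w : w = 2 * e ^ 2 + 4 * e + 1 + s * e.+1 by rewrite def_w def_y; ring.
  move: {s def_y lt_y} (s * e.+1) def_w => r def_w.
  apply: (@leq_trans ((2 * e ^ 2 + 2 * e + 4 + r) * (2 * e ^ 2 + 2 * e + 4 + r))).
    have -> : (2 * e ^ 2 + 2 * e + 4 + r) * (2 * e ^ 2 + 2 * e + 4 + r) =
      (2 * e ^ 2 + 4 * e + r) * (2 * e ^ 2) +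
      (20 * e ^ 2 + 16 * e + 16 + 2 * e ^ 2 * r + 4 * e * r + 8 * r + r ^ 2) by ring.
    rewrite -[leqLHS]addn1 leq_add //; last by rewrite !addnA !addnS.
    by rewrite leq_mul2r; apply/orP; right; lia.
  by apply: leq_mul; lia.
have {}def_w : w = 2 * e ^ 2 + 3 * e by rewrite def_w def_y; ring.
apply: (@leq_trans ((2 * e ^ 2 + e + 3) * (2 * e ^ 2 + 3 * e + 5))).
  have -> : (2 * e ^ 2 + e + 3) * (2 * e ^ 2 + 3 * e + 5) =
     (2 * e ^ 2 + 3 * e) * (2 * e ^ 2) + (2 * e ^ 3 + 19 * e ^ 2 + 14 * e + 15) by ring.
  rewrite -[leqLHS]addn1 leq_add //; last by rewrite !addnS.
  by rewrite leq_mul2r; apply/orP; right; lia.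
by apply: leq_mul; lia.
Qed.

(** With z = y + d, the first inequality gives e d < y, and the second one gives
y > 2e if d = 0 and y >= 2e if d = 1; for d >= 2 the first suffices. *)
Lemma block_count_large e y z : 1 < e -> 1 < y -> y <= z ->
    e * z + e.+1 <= y * e.+1 + e ->
    y * e.+1 + 2 * (y * e) + e.+2 <= y ^ 2 + (z * e.+1 + e) ->
  2 * e < y \/ (y = 2 * e /\ y < z).
Proof.
move=> e_gt1 y_gt1 le_yz roos bound; case: (ltnP (2 * e) y) => [|le_y]; [by left|right].
have [d def_z] : exists d, z = y + d by exists (z - y); lia.
subst z; have le_d : d <= 1 by nia.
case: d le_d roos bound le_yz => [|[|]] // _ roos bound _; first by nia.
split; last by lia.
by apply/eqP; rewrite eqn_leq le_y leqNgt; apply/negP => lt_y; nia.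
Qed.

(** The left binomial coefficient is a multiple of 2^k because its upper index is
and its lower index is odd. A multiple of 2^k must then occur among
w - e, ..., w - e + 2l, which locates w modulo 2^k relative to e. *)
Lemma residue_of_bin_dvd k e l w : 0 < k -> 2 ^ k %| e + (2 * l).+1 ->
    4 * l <= 2 ^ k.-1 -> e < w ->
    'C(e + (2 * l).+1, (2 * l).+1) %| 'C(w - e.+1 + (2 * l).+1, (2 * l).+1) ->
  exists N p, [/\ w = N + p, 2 ^ k %| N, (2 ^ k.-1).-1 <= p & p <= e %% 2 ^ k].
Proof.
move=> k_gt0 dvd_e le_l lt_ew dvd_C.
have pk : 2 ^ k = 2 * 2 ^ k.-1 by rewrite -expnS prednK.
have q_gt0 : 0 < 2 ^ k.-1 by rewrite expn_gt0.
have dvd_kC : 2 ^ k %| 'C(w - e.+1 + (2 * l).+1, (2 * l).+1).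
  apply: dvdn_trans dvd_C; apply: (@dvdn_binl 2 k 0) => //; first by rewrite addn0.
  by rewrite dvdn2 /= oddM.
have lt_l : 0 < (2 * l).+1 < 2 ^ k by rewrite pk; move: q_gt0 le_l; clear; lia.
have := modn_lt_of_dvd_bin dvd_kC lt_l (leq_addl _ _).
set M := w - e.+1 + (2 * l).+1; set r := M %% 2 ^ k => lt_r.
have def_M := divn_eq M (2 ^ k); rewrite -/r in def_M.
have /dvdnP[c def_e] := dvd_e.
have c_gt0 : 0 < c by case: c def_e => //; rewrite mul0n addnS.
have mod_e : e %% 2 ^ k = 2 ^ k - (2 * l).+1.
  have -> : e = c.-1 * 2 ^ k + (2 ^ k - (2 * l).+1).
    move: def_e lt_l; rewrite -{1}(prednK c_gt0) mulSn; clear; lia.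
  by rewrite modnMDl modn_small //; move: lt_l; clear; lia.
exists ((M %/ 2 ^ k + c.-1) * 2 ^ k), (r + 2 ^ k - (4 * l).+1).
rewrite dvdn_mull // mod_e; split=> //; last 2 first.
- by move: le_l q_gt0; rewrite pk; clear; lia.
- by move: lt_r; clear; lia.
have def_w : M = w - e.+1 + (2 * l).+1 by [].
have {}def_e : e + (2 * l).+1 = 2 ^ k + c.-1 * 2 ^ k by rewrite def_e -mulSn prednK.
have le_8l : (8 * l <= 2 ^ k) && (0 < 2 ^ k).
  by rewrite pk; move: le_l q_gt0; clear; lia.
rewrite mulnDl; move: def_e def_M def_w le_8l lt_r lt_ew.
move: (M %/ 2 ^ k * 2 ^ k) (c.-1 * 2 ^ k) (2 ^ k) => u v K.
by clearbody r M; clear; lia.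
Qed.

(** A second codeword forces w >= 2e + 1, and then w = 2e + 1 would force
a = 2e + 1 and a pair of complementary codewords. *)
Theorem no_perfect_cover (T : finType) n w e k l (C : {set {set T}}) :
    #|T| = n -> w <= n - w -> perfect_cover w e C ->
    2 < k -> 1 < e -> odd e -> 4 * l <= 2 ^ k.-1 -> 2 * l <= e ->
    2 ^ k %| e + (2 * l).+1 -> #|C| != 1 ->
    ~ (n = 2 * w /\ w = (2 * e).+1 /\ exists2 X : {set T}, #|X| = w & C = [set X; ~: X]) ->
  False.
Proof.
move=> card_T le_wa perfC k_gt2 e_gt1 e_odd le_l le_le dvd_e neC ntriv.
have [le_wn|lt_nw] := leqP w n; last first.
  have w0 : w = 0 by move: le_wa lt_nw; clear; lia.
  by move: lt_nw; rewrite w0.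
have [cardC _] := perfC.
have [X CX] := exists_codeword perfC card_T le_wn.
have [Z CZ neXZ] : exists2 Z, Z \in C & X != Z.
  apply/exists_inP; apply: contraR neC => /exists_inPn allX; apply/cards1P.
  exists X; apply/setP => Z; rewrite inE; apply/idP/eqP => [CZ|->] //.
  by apply/esym/eqP; rewrite -[_ == _]negbK allX.
have le_ew : (2 * e).+1 <= w.
  apply: leq_trans (min_distance perfC CX CZ neXZ) _.
  by rewrite -(cardC _ CX) subset_leq_card // subsetDl.
have lt_ew : e < w by move: le_ew; clear; lia.
have lt_ea : e < n - w := leq_trans lt_ew le_wa.
have le_an : n - w <= n := leq_subr _ _.
have perfC' := perfect_cover_compl card_T le_wn perfC.
have [y def_w roos_w] := card_quotient_roos perfC card_T le_wn lt_ew lt_ea.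
have lt_ew' : e < n - (n - w) by rewrite subKn.
have [z def_a roos_a] := card_quotient_roos perfC' card_T le_an lt_ea lt_ew'.
rewrite subKn // in roos_a.
have [a def_na] : exists a, n - w = a by eexists.
rewrite def_na in le_wa lt_ea le_an perfC' roos_w def_a.
have def_n : n = w + a by rewrite -def_na subnKC.
have le_yz : y <= z by move: le_wa; rewrite def_w def_a leq_add2r leq_pmul2r.
have y_gt1 : 1 < y.
  rewrite ltnNge; apply/negP => le_y.
  have def_y : y = 1 by move: le_ew; rewrite def_w; case: y le_y {def_w roos_w le_yz} => [|[]] //; lia.
  have def_w' : w = (2 * e).+1 by rewrite def_w def_y; clear; lia.
  have def_z : z = 1.
    apply/eqP; rewrite eqn_leq andbC -{1}def_y le_yz leqNgt; apply/negP => lt_z.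
    have := leq_mul (leqnn e) lt_z; move: roos_a e_gt1; rewrite def_w'; clear; lia.
  have def_a' : a = w by rewrite def_a def_z def_w def_y.
  apply: ntriv; split; first by rewrite def_n def_a'; clear; lia.
  split=> //; exists X; first exact: cardC.
  have complX Y : Y \in C -> X != Y -> Y = ~: X.
    move=> CY neXY; have far := min_distance perfC CX CY neXY.
    have cXY : X :\: Y = X.
      by apply/eqP; rewrite eqEcard subsetDl (cardC _ CX) def_w'.
    apply/eqP; rewrite eqEcard (cards_compl card_T) (cardC _ CX) (cardC _ CY) def_na def_a' leqnn andbT.
    by rewrite -disjoints_subset disjoint_sym; apply/setDidPl.
  apply/setP => Y; rewrite !inE; apply/idP/orP => [CY|[/eqP -> //|/eqP ->]].
    by have [->|neXY] := eqVneq Y X; [left|right; apply/eqP/complX; rewrite // eq_sym].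
  by rewrite -(complX Z CZ neXZ).
have lt_roos : e * y + e.+1 < a.
  rewrite def_a; have := leq_mul le_yz (leqnn e.+1); move: y_gt1 e_gt1; clear.
  by lia.
have bound := two_sunflowers_bound perfC card_T le_wn lt_ew def_w.
rewrite def_na in bound; move/(_ lt_roos) in bound.
have big : 2 * e < y \/ y = 2 * e /\ w + e.+1 <= a.
  rewrite def_w in roos_a; rewrite {1}def_a in bound.
  case: (block_count_large e_gt1 y_gt1 le_yz roos_a bound) => [|[def_y lt_yz]]; [by left|right].
  split=> //; rewrite def_w def_a; have := leq_mul lt_yz (leqnn e.+1).
  by clear; lia.
pose s := trunc_log 2 w.
have w_gt0 : 0 < w by apply: leq_ltn_trans lt_ew.
have /andP[le_s lt_s] := trunc_log_bounds (isT : 1 < 2) w_gt0; rewrite -/s in le_s lt_s.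
have lloyd_pos m : 0 < m <= w - 2 ^ s -> (lloyd w a e m != 0)%R.
  case/andP=> m_gt0 le_m; rewrite gt_eqF //; apply: lloyd_gt0.
  apply: (first_ratio_small e_gt1 def_w le_wa big m_gt0).
  by move: le_m lt_s le_s; rewrite expnS; clear; lia.
have le_ts : w - 2 ^ s <= #|[set: T]|.
  by rewrite cardsT card_T; apply: leq_trans (leq_subr _ _) le_wn.
have [A _ cA] := exists_subset_card le_ts.
have le_ta : w - 2 ^ s <= a := leq_trans (leq_subr _ _) le_wa.
have := perfect_code_design card_T perfC (leq_subr (2 ^ s) w).
rewrite def_na => /(_ le_ta (ltnW lt_ea) lloyd_pos A); rewrite cA leqnn => /(_ isT).
have -> : n - (w - 2 ^ s) = a + 2 ^ s by rewrite def_n; move: le_s; clear; lia.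
rewrite subKn // => count.
have le_j : (2 * l).+1 <= e.+1 by [].
have dvd_w := steiner_dvd perfC card_T le_wn lt_ew; rewrite def_na in dvd_w.
have dvd_a := steiner_dvd perfC' card_T le_an lt_ea.
have def_nw : n - a = w by rewrite def_n addnK.
rewrite def_nw in dvd_a.
have k_gt0 : 0 < k by apply: leq_trans k_gt2.
have := residue_of_bin_dvd k_gt0 dvd_e le_l lt_ew (dvd_w _ lt_ea le_j).
case=> N [p [def_wN dvd_N le_p p_le]].
have := residue_of_bin_dvd k_gt0 dvd_e le_l lt_ea (dvd_a _ lt_ew le_j).
case=> M [r [def_aM dvd_M le_r r_le]].
have even_dvd K : 2 ^ k %| K -> ~~ odd K.
  move=> dvd_K; rewrite -dvdn2; apply: dvdn_trans dvd_K.
  by rewrite -{1}(expn1 2) dvdn_exp2l.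
have odd_part c K u : c = K + u -> 2 ^ k %| K -> odd c -> odd u.
  by move=> -> /even_dvd; rewrite oddD => /negbTE ->.
have p_odd : odd p.
  by apply: (odd_part _ _ _ def_wN dvd_N); rewrite def_w oddD oddM /= e_odd andbF.
have r_odd : odd r.
  by apply: (odd_part _ _ _ def_aM dvd_M); rewrite def_a oddD oddM /= e_odd andbF.
have four_dvd : 4 %| 'C(a + 2 ^ s, 2 ^ s).
  rewrite -count dvdn_mulr // def_wN def_aM.
  exact: (four_dvd_ball_size k_gt2 dvd_N dvd_M p_odd r_odd le_p le_r p_le r_le).
have lt_a : a < 3 * 2 ^ s.
  have le_ez : 2 * z <= e * z by rewrite leq_mul2r e_gt1 orbT.
  move: lt_s roos_a le_ez e_gt1; rewrite expnS def_a mulnS [z * e]mulnC.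
  by move: (e * z) (2 ^ s); clear; lia.
have := logn_bin_pow2 lt_a; apply/negP; rewrite -ltnNge.
by rewrite -pfactor_dvdn ?bin_gt0 ?leq_addl.
Qed.

Lemma perfect_code_cover n w e (C : {set {set 'I_n}}) :
  perfect_code w e C -> perfect_cover w e C.
Proof.
case=> sCJ disjC coverC; split=> [X CX|Y cY].
  by have := subsetP sCJ X CX; rewrite inE => /eqP.
have : Y \in johnson n w by rewrite inE cY.
rewrite -coverC => /bigcupP[X CX]; rewrite inE => /andP[_ dXY].
apply/eqP/cards1P; exists X; apply/setP => Z; rewrite !inE.
apply/andP/eqP => [[CZ dZY]|->]; last by [].
apply/eqP; apply: contraT => neZX; have := disjC _ _ CZ CX neZX.
rewrite -setI_eq0 => /eqP/setP/(_ Y).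
by rewrite !inE cY eqxx /johnson_dist dZY dXY.
Qed.

Theorem theorem4p3 (k e l : nat) (hk : 3 <= k) (he : 1 <= e)
    (hl : l <= 2 ^ (k - 3))
    (hmod : (e%:Z = - (2 * l%:Z + 1) %[mod 2 ^+ k])%Z) :
  forall n w : nat, 1 <= w <= n - 1 ->
    ~ exists C : {set {set 'I_n}}, nontrivial_perfect_code w e C.
Proof.
move=> n w /andP[w_gt0 le_wn1] [C [perfC ntriv]].
have dvd_e : 2 ^ k %| e + (2 * l).+1.
  move/eqP: hmod; rewrite eqz_mod_dvd opprK dvdzE abszX.
  by have -> : (e%:Z + (2 * l%:Z + 1) = (e + (2 * l).+1)%:Z)%R by lia.
have le_k : 2 ^ k <= e + (2 * l).+1 by rewrite dvdn_leq // addnS.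
have def_k : 2 ^ k = 8 * 2 ^ (k - 3) by rewrite -[8]/(2 ^ 3) -expnD subnKC.
have def_k1 : 2 ^ k.-1 = 4 * 2 ^ (k - 3).
  by rewrite -[4]/(2 ^ 2) -expnD; congr (2 ^ _); move: hk; clear; lia.
have Q_gt0 : 0 < 2 ^ (k - 3) by rewrite expn_gt0.
have e_gt1 : 1 < e by move: le_k; rewrite def_k; move: hl Q_gt0; clear; lia.
have le_le : 2 * l <= e by move: le_k; rewrite def_k; move: hl Q_gt0; clear; lia.
have le_l : 4 * l <= 2 ^ k.-1 by rewrite def_k1 leq_mul2l.
have e_odd : odd e.
  have : 2 %| e + (2 * l).+1.
    by apply: dvdn_trans dvd_e; rewrite def_k dvdn_mulr.
  by rewrite dvdn2 oddD /= oddM /= addbT negbK.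
have coverC := perfect_code_cover perfC.
have neC : #|C| != 1 by apply/eqP => cC; apply: ntriv; apply: Or32.
have le_wn : w <= n := leq_trans le_wn1 (leq_subr _ _).
have [le_wa|lt_aw] := leqP w (n - w).
  apply: (no_perfect_cover (card_ord n) le_wa coverC hk e_gt1 e_odd le_l le_le dvd_e neC).
  case=> def_n [def_w [X cX defC]]; apply: ntriv; apply: Or33.
  split; rewrite -?mul2n //; exists X => //; by rewrite inE cX.
have coverC' := perfect_cover_compl (card_ord n) le_wn coverC.
have le_aw : n - w <= n - (n - w) by rewrite subKn // ltnW.
apply: (no_perfect_cover (card_ord n) le_aw coverC' hk e_gt1 e_odd le_l le_le dvd_e).
  by rewrite card_imset //; apply: setC_inj.
by case=> def_n _; move: lt_aw; rewrite {1}def_n; move: def_n le_wn; clear; lia.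
Qed.
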